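(* Let $(A,d_A,m_A)$ and $(B,d_B,m_B)$ be dg commutative algebras and $(\sigma,\tau,h)$ a semifull algebra contraction of $(A,d_A,m_A)$ onto $(B,d_B,m_B)$. Suppose maps $\lambda_n:A^{\otimes n}\to A$, $n\ge2$, make $(A,\lambda_1=d_A,\lambda_2,\lambda_3,\dots)$ a degree $k$ derived Poisson algebra. Let $\ell_n:B^{\otimes n}\to B$ ($n\ge2$) and $\tau_\infty=(\tau_1,\tau_2,\dots)$ be the transferred $L_\infty$ structure on $B[-k]$ and the $L_\infty$ quasi-isomorphism $B[-k]\to A[-k]$ given by homotopy transfer along $(\sigma,\tau,h)$, i.e. $\tau_1=\tau$ and recursively $$\tau_{n+1}(x_1,\dots,x_n,y)=\sum\pm\tfrac{1}{(p-1)!}\,h\lambda_p\big(\tau_{i_1}(x_{\sigma(1)},\dots),\dots,\tau_{i_p+1}(\dots,x_{\sigma(n)},y)\big),$$ $$\ell_{n+1}(x_1,\dots,x_n,y)=\sum\pm\tfrac{1}{(p-1)!}\,\sigma\lambda_p\big(\tau_{i_1}(x_{\sigma(1)},\dots),\dots,\tau_{i_p+1}(\dots,x_{\sigma(n)},y)\big),$$ the sums running over $p\ge2$, $i_1,\dots,i_{p-1}\ge1$, $i_p\ge0$ with $i_1+\dots+i_p=n$ and over $(i_1,\dots,i_p)$-shuffles $\sigma$, with the appropriate Koszul signs. Then $(B,\ell_1=d_B,\ell_2,\ell_3,\dots)$ is a degree $k$ derived Poisson algebra (with product $m_B$), and $\tau_\infty$ is a morphism of degree $k$ derived Poisson algebras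 from $B$ to $A$.
   Context: A contraction $(\sigma,\tau,h)$ of a cochain complex $(A,d_A)$ onto $(B,d_B)$ consists of cochain maps $\sigma:A\to B$, $\tau:B\to A$ and a degree $-1$ map $h:A\to A$ with $\sigma\tau=\mathrm{id}_B$, $hd_A+d_Ah=\tau\sigma-\mathrm{id}_A$, $\sigma h=0$, $h\tau=0$, $h^2=0$. For dg commutative algebras it is a semifull algebra contraction if for all $a,b\in A$, $x,y\in B$: $h((-1)^{|a|+1}h(a)b+ah(b))=h(a)h(b)$; $h(a\tau(x))=h(a)\tau(x)$; $\sigma((-1)^{|a|+1}h(a)b+ah(b))=0$; $\sigma(a\tau(x))=\sigma(a)x$; $\tau(xy)=\tau(x)\tau(y)$. A degree $k$ derived Poisson algebra is a graded commutative algebra $\mathcal A$ with multilinear maps $\lambda_n:\mathcal A^{\otimes n}\to\mathcal A$ of degree $k(n-1)+2-n$, graded antisymmetric and forming an $L_\infty$ algebra on $\mathcal A[-k]$, each $a\mapsto\lambda_n(a_1,\dots,a_{n-1},a)$ a graded derivation. A morphism $\mathcal B\to\mathcal A$ of such is a family $f_n:\mathcal B^{\otimes n}\to\mathcal A$ of degree $(k-1)(n-1)$, graded symmetric as degree $0$ maps $\mathcal B[1-k]^{\otimes n}\to\mathcal A[1-k]$, which after décalage is an $L_\infty$ morphism $\mathcal B[-k]\to\mathcal A[-k]$, and satisfies $f_{n+1}(x_1,\dots,x_n,yz)=\sum_{i=0}^n\sum_{\sigma\in\mathrm{Sh}(i,n-i)}(-1)^{\diamond}f_{i+1}(x_{\sigma(1)},\dots,x_{\sigma(i)},y)f_{n-i+1}(x_{\sigma(i+1)},\dots,x_{\sigma(n)},z)$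 with $\diamond=\epsilon(\sigma)+|y|((n-i)(k-1)+|x_{\sigma(i+1)}|+\dots+|x_{\sigma(n)}|)$, $\epsilon(\sigma)$ the Koszul sign with $x_j$ of degree $|x_j|+k-1$. *)

(* Defs.v *)
From HB Require Import structures.
From mathcomp Require Import all_boot all_order all_algebra.
Set Implicit Arguments. Unset Strict Implicit. Unset Printing Implicit Defensive.
Import GRing.Theory.
Local Open Scope ring_scope.

(*  - A graded vector space is a K-vector space V together with the family *)
(*    of its homogeneous components gr i (i : int), given as predicates.  *)
(*  - Multi-ary operations (brackets l_n, L_oo-morphism components f_n)    *)
(*    are encoded as ONE function on lists, the arity being the length.   *)
(*  - Inputs of length n are given as x : 'I_n -> V with degrees          *)
(*    d : 'I_n -> int.                                                     *)
(*  - An (i_1,...,i_p)-(un)shuffle is encoded by the "colouring"          *)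
(*    c : 'I_n -> 'I_p sending each input to the block it goes to; the    *)
(*    blocks keep the original order. Its Koszul sign is the product of   *)
(*    (-1)^(deg a * deg b) over the inverted pairs a < b, c b < c a.      *)
(*  - Brackets and morphisms are given in their decalage (shifted) form:  *)
(*    graded symmetric w.r.t. the shifted degree |a| + k - 1 (i.e. on     *)
(*    A[1-k]), with the L_oo[1] sign conventions.                         *)

Definition ksign (K : fieldType) (z : int) : K := (-1) ^+ `|z|%N.

Definition lst (T : Type) (n : nat) (x : 'I_n -> T) : seq T := map x (enum 'I_n).

Definition blk (T : Type) (n p : nat) (x : 'I_n -> T) (c : 'I_n -> 'I_p) (j : 'I_p)
  : seq T := [seq x a | a <- [seq a <- enum 'I_n | c a == j]].

(* Koszul sign of the unshuffle encoded by c, inputs of shifted degree d a + s *)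
Definition kcol (K : fieldType) (s : int) (n p : nat) (d : 'I_n -> int)
  (c : 'I_n -> 'I_p) : K :=
  \prod_(a < n) \prod_(b < n | (a < b)%N && (c b < c a)%N)
     ksign K ((d a + s) * (d b + s)).

Section Defs.
Variable K : fieldType.

Definition homog (V : lmodType K) (gr : int -> pred V) (n : nat)
  (x : 'I_n -> V) (d : 'I_n -> int) : Prop := forall a, gr (d a) (x a).

Definition graded_space (V : lmodType K) (gr : int -> pred V) : Prop :=
  [/\ (forall i, gr i 0),
      (forall i (a : K) u v, gr i u -> gr i v -> gr i (a *: u + v)),
      (forall v, exists s : seq (int * V),
          all (fun q => gr q.1 q.2) s /\ v = \sum_(q <- s) q.2) &
      (forall s : seq (int * V), uniq (map fst s) ->
          all (fun q => gr q.1 q.2) s -> \sum_(q <- s) q.2 = 0 ->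
          all (fun q => q.2 == 0) s)].

Definition lin (V W : lmodType K) (f : V -> W) : Prop :=
  forall (a : K) u v, f (a *: u + v) = a *: f u + f v.

Definition of_degree (V W : lmodType K) (grV : int -> pred V) (grW : int -> pred W)
  (e : int) (f : V -> W) : Prop := forall i v, grV i v -> grW (i + e) (f v).

Definition gca (V : lmodType K) (gr : int -> pred V) (mul : V -> V -> V) : Prop :=
  [/\ (forall u, lin (mul u)), (forall v, lin (mul^~ v)),
      (forall i j u v, gr i u -> gr j v -> gr (i + j) (mul u v)),
      (forall u v w, mul (mul u v) w = mul u (mul v w)) &
      (forall i j u v, gr i u -> gr j v -> mul u v = ksign K (i * j) *: mul v u)].

Definition dgca (V : lmodType K) (gr : int -> pred V) (mul : V -> V -> V)
  (d : V -> V) : Prop :=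
  [/\ gca gr mul, lin d, of_degree gr gr 1 d, (forall v, d (d v) = 0) &
      (forall i u v, gr i u -> d (mul u v) = mul (d u) v + ksign K i *: mul u (d v))].

Definition contraction (A B : lmodType K) (grA : int -> pred A) (grB : int -> pred B)
  (dA : A -> A) (dB : B -> B) (sigma : A -> B) (tau : B -> A) (h : A -> A) : Prop :=
  [/\ [/\ lin sigma, lin tau, lin h & of_degree grA grB 0 sigma],
      of_degree grB grA 0 tau /\ of_degree grA grA (-1) h,
      [/\ (forall a, sigma (dA a) = dB (sigma a)),
          (forall x, tau (dB x) = dA (tau x)) &
          (forall x, sigma (tau x) = x)],
      (forall a, h (dA a) + dA (h a) = tau (sigma a) - a) &
      [/\ (forall a, sigma (h a) = 0), (forall x, h (tau x) = 0) &
          (forall a, h (h a) = 0)]].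

Definition semifull (A B : lmodType K) (grA : int -> pred A)
  (mulA : A -> A -> A) (mulB : B -> B -> B)
  (sigma : A -> B) (tau : B -> A) (h : A -> A) : Prop :=
  [/\ (forall i a b, grA i a ->
         h (ksign K (i + 1) *: mulA (h a) b + mulA a (h b)) = mulA (h a) (h b)),
      (forall a x, h (mulA a (tau x)) = mulA (h a) (tau x)),
      (forall i a b, grA i a ->
         sigma (ksign K (i + 1) *: mulA (h a) b + mulA a (h b)) = 0),
      (forall a x, sigma (mulA a (tau x)) = mulB (sigma a) x) &
      (forall x y, tau (mulB x y) = mulA (tau x) (tau y))].

Definition multilin (V W : lmodType K) (f : seq V -> W) : Prop :=
  forall (xs ys : seq V) (a : K) u v,
    f (xs ++ (a *: u + v) :: ys) = a *: f (xs ++ u :: ys) + f (xs ++ v :: ys).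

Definition shsym (V W : lmodType K) (gr : int -> pred V) (k : int) (f : seq V -> W)
  : Prop :=
  forall (xs ys : seq V) i j u v, gr i u -> gr j v ->
    f (xs ++ v :: u :: ys) = ksign K ((i + k - 1) * (j + k - 1)) *: f (xs ++ u :: v :: ys).

(* L_oo[1] relations (decalage form, shifted degrees d a + s) *)
Definition linf1 (V : lmodType K) (gr : int -> pred V) (s : int) (l : seq V -> V)
  : Prop :=
  forall n (x : 'I_n -> V) (d : 'I_n -> int), homog gr x d ->
    \sum_(c : {ffun 'I_n -> 'I_2} | [exists a, c a == ord0])
        kcol K s d c *: l (l (blk x c ord0) :: blk x c ord_max) = 0.

(* degree k derived Poisson algebra; l is the family lambda_1, lambda_2, ...  *)
(* in decalage form (l_n graded symmetric on V[1-k], of degree 1 there).      *)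
Definition derived_poisson (k : int) (V : lmodType K) (gr : int -> pred V)
  (mul : V -> V -> V) (l : seq V -> V) : Prop :=
  gca gr mul /\
  [/\ multilin l,
      (forall n (x : 'I_n -> V) d, (0 < n)%N -> homog gr x d ->
          gr (\sum_(a < n) d a + (n%:Z - 1) * k + 2 - n%:Z) (l (lst x))),
      shsym gr k l, linf1 gr (k - 1) l &
      (forall n (x : 'I_n -> V) d i u v, homog gr x d -> gr i u ->
          l (rcons (lst x) (mul u v)) =
          mul (l (rcons (lst x) u)) v
          + ksign K (i * (1 + \sum_(a < n) (d a + k - 1))) *: mul u (l (rcons (lst x) v)))].

Definition dp_morphism (k : int) (B A : lmodType K) (grB : int -> pred B)
  (grA : int -> pred A) (mulB : B -> B -> B) (mulA : A -> A -> A)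
  (lB : seq B -> B) (lA : seq A -> A) (f : seq B -> A) : Prop :=
  [/\ multilin f,
      (forall n (x : 'I_n -> B) d, (0 < n)%N -> homog grB x d ->
          grA (\sum_(a < n) d a + (k - 1) * (n%:Z - 1)) (f (lst x))),
      shsym grB k f,
      (* L_oo[1]-morphism relation (after decalage) *)
      (forall n (x : 'I_n -> B) d, (0 < n)%N -> homog grB x d ->
         \sum_(c : {ffun 'I_n -> 'I_2} | [exists a, c a == ord0])
             kcol K (k - 1) d c *: f (lB (blk x c ord0) :: blk x c ord_max)
         = \sum_(p < n.+1 | (0 < p)%N) ((p`!)%:R)^-1 *:
             \sum_(c : {ffun 'I_n -> 'I_p} | [forall j, [exists a, c a == j]])
                kcol K (k - 1) d c *: lA [seq f (blk x c j) | j <- enum 'I_p]) &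
      (forall n (x : 'I_n -> B) d i y z, homog grB x d -> grB i y ->
         f (rcons (lst x) (mulB y z)) =
         \sum_(c : {ffun 'I_n -> 'I_2})
            (kcol K (k - 1) d c
             * ksign K (i * \sum_(a < n | c a == ord_max) (d a + k - 1))) *:
            mulA (f (rcons (blk x c ord0) y)) (f (rcons (blk x c ord_max) z)))].

(* Right-hand side of the homotopy transfer recursion:                       *)
(*  sum_{p>=2} 1/(p-1)! sum_{(i_1..i_p)-shuffles, i_1..i_{p-1}>=1, i_p>=0}    *)
(*     eps(sigma) g lA(T(x..), ..., T(x.., y))                                *)
(* with g = h (for tau_{n+1}) or g = sigma (for l_{n+1}).                    *)
Definition transfer_rhs (A B W : lmodType K) (s : int) (lA : seq A -> A)
  (T : seq B -> A) (g : A -> W) (n : nat) (x : 'I_n -> B) (d : 'I_n -> int) (y : B)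
  : W :=
  \sum_(p < n.+2 | (2 <= p)%N) (((p.-1)`!)%:R)^-1 *:
    \sum_(c : {ffun 'I_n -> 'I_p} |
            [forall j : 'I_p, (val j != p.-1) ==> [exists a, c a == j]])
       kcol K s d c *:
         g (lA [seq (if val j == p.-1 then T (rcons (blk x c j) y) else T (blk x c j))
               | j <- enum 'I_p]).

End Defs.

(* Main.v *)
(* Fix inputs x and let y be one more input, in the last position.  Summing over
   the partitions of x gives a twisted bracket, an operator L on A which depends
   on the transferred morphism t evaluated on fewer inputs; both sums of the
   homotopy transfer become t(x,y) = tau(y) + h L t(x,y) and
   l(x,y) = d(y) + sigma L t(x,y) in the convolution algebra of unshuffles.

   L-infinity relations: the relations of A say that d + L kills the curvature
   C = sum of lambda(t,...,t).  With dh + hd = tau sigma - id this gives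
   C = tau l + h L C, the same fixed point equation as for the composite t l,
   hence C = t l, and applying sigma the relations for l follow.

   Products: L is a derivation, so with u = L t(x,y), v = L t(x,z) the
   expression h L (t(x,y) t(x,z)) is h(u t(x,z) +- t(x,y) v), which the semifull
   identities turn into t(x,y) t(x,z) - tau(y) tau(z); likewise with sigma
   for l. *)

Require Import Defs.
From HB Require Import structures.
From mathcomp Require Import all_boot all_order all_algebra.
From mathcomp Require Import zify ring.
Import GRing.Theory.
Local Open Scope ring_scope.
Set Implicit Arguments. Unset Strict Implicit. Unset Printing Implicit Defensive.

(** * Signs and unshuffles *)

(** The degrees and the graded symmetry of the transferred maps have to be extracted from a
    recursion that singles out the last input. In a partition into unordered blocks some block
    contains the last input anyway, so the transfer formula is a sum over all such partitions, in
    which no input is distinguished; symmetry comes from there. Trading ordered blocks with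
    factorials for unordered ones divides by factorials and uses the symmetry of the brackets of A
    on the values t(b), hence the degrees of these values. So the degrees are found first, from the
    ordered form.

    The recursion expands a map at its last input, whereas the L-infinity relations put the inner
    bracket first. Symmetry therefore also has to precede these relations: it carries the inner
    bracket to the place where the recursion can be unfolded.

    L vanishes when it receives no input from x, so fixed point equations are solved by induction on
    the number of inputs and no convergence question arises. *)

Section Sign.
Variable K : fieldType.
Notation sg := (ksign K).

Lemma ksignE z : sg z = (-1) ^+ odd `|z|%N.
Proof. by rewrite /ksign signr_odd. Qed.

Lemma ksignD a b : sg (a + b) = sg a * sg b.
Proof.
rewrite !ksignE -signr_addb; congr (_ ^+ _).
by have -> : odd `|(a + b)%R|%N = odd `|a|%N (+) odd `|b|%N by lia.
Qed.

Lemma ksign0 : sg 0 = 1. Proof. by []. Qed.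

(** Naming half of the difference turns a congruence modulo 2 between Koszul exponents into a
    polynomial identity for [ring]. *)
Lemma ksign_mod2 c a b : a = b + c + c -> sg a = sg b.
Proof. by move=> ->; rewrite !ksignD -mulrA !ksignE -signr_addb addbb mulr1. Qed.

Lemma ksign_sum I (r : seq I) (P : pred I) (F : I -> int) :
  sg (\sum_(i <- r | P i) F i) = \prod_(i <- r | P i) sg (F i).
Proof. exact: (big_morph _ ksignD ksign0). Qed.
End Sign.

Section Linear.
Variables (K : fieldType) (V W : lmodType K) (f : V -> W).
Hypothesis Lf : lin f.

Lemma linD u v : f (u + v) = f u + f v.
Proof. by have := Lf 1 u v; rewrite !scale1r. Qed.
Lemma lin0 : f 0 = 0.
Proof. by apply: (addrI (f 0)); rewrite -linD !addr0. Qed.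
Lemma linZ a u : f (a *: u) = a *: f u.
Proof. by have := Lf a u 0; rewrite lin0 !addr0. Qed.
Lemma linN u : f (- u) = - f u.
Proof. by rewrite -scaleN1r linZ scaleN1r. Qed.
Lemma lin_sum I (r : seq I) (P : pred I) (F : I -> V) :
  f (\sum_(i <- r | P i) F i) = \sum_(i <- r | P i) f (F i).
Proof. exact: (big_morph _ linD lin0). Qed.
End Linear.

(** * The unshuffle coproduct and its iterates *)

Section Splits.
Variables (K : fieldType) (V : Type).
Notation X := (int * V)%type.
Notation sg := (ksign K).

Definition dg (l : seq X) : int := \sum_(q <- l) q.1.

Lemma dg_nil : dg [::] = 0. Proof. exact: big_nil. Qed.
Lemma dg_cons x l : dg (x :: l) = x.1 + dg l. Proof. exact: big_cons. Qed.
Lemma dg_rev l : dg (rev l) = dg l.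
Proof. by rewrite /dg; elim: l => // x l IH; rewrite rev_cons -cats1 big_cat big_seq1 big_cons addrC IH. Qed.

(* Inputs are pairs (shifted degree, vector), stored last first: the head of
   [l] is the last input.  [spl l Phi] sums [Phi] over the (i, j)-unshuffles of
   [l] with their Koszul signs; the last input [x] either closes the right
   block, or moves to the left one across the elements [l2]. *)
Fixpoint spl (W : lmodType K) (l : seq X) (Phi : seq X -> seq X -> W) : W :=
  if l is x :: l' then
    spl l' (fun l1 l2 => Phi l1 (x :: l2))
    + spl l' (fun l1 l2 => sg (x.1 * dg l2) *: Phi (x :: l1) l2)
  else Phi [::] [::].

Section SplTheory.
Variable W : lmodType K.
Implicit Types (Phi Psi : seq X -> seq X -> W).

(** A single induction covers equality of sums ([eq_spl_in]) and closure properties ([spl_closed]).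
    The size and degree equations are recorded because later inductions need shorter halves, and
    signs need the total degree. *)
Lemma spl_ind2 (P : W -> W -> Prop) (h : pred X) l Phi Psi :
  (forall a b c d, P a b -> P c d -> P (a + c) (b + d)) ->
  (forall z a b, P a b -> P (sg z *: a) (sg z *: b)) ->
  all h l ->
  (forall l1 l2, all h l1 -> all h l2 -> (size l1 + size l2 = size l)%N ->
      dg l1 + dg l2 = dg l -> P (Phi l1 l2) (Psi l1 l2)) ->
  P (spl l Phi) (spl l Psi).
Proof.
move=> PD PZ; elim: l Phi Psi => [|x l IH] Phi Psi /=.
  by move=> _; apply; rewrite ?dg_nil.
move=> /andP[hx hl] H; apply: PD; apply: IH => // l1 l2 h1 h2 sz dgE.
  by apply: H => //=; rewrite ?hx // ?addnS ?sz // !dg_cons -dgE; ring.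
by apply: PZ; apply: H => //=; rewrite ?hx // ?addSn ?sz // !dg_cons -dgE; ring.
Qed.

Lemma eq_spl_in (h : pred X) l Phi Psi : all h l ->
  (forall l1 l2, all h l1 -> all h l2 -> (size l1 + size l2 = size l)%N ->
      dg l1 + dg l2 = dg l -> Phi l1 l2 = Psi l1 l2) ->
  spl l Phi = spl l Psi.
Proof. by apply: spl_ind2 => [a b c d -> ->|z a b ->]. Qed.

Lemma eq_spl_dg l Phi Psi :
  (forall l1 l2, (size l1 + size l2 = size l)%N ->
      dg l1 + dg l2 = dg l -> Phi l1 l2 = Psi l1 l2) ->
  spl l Phi = spl l Psi.
Proof. by move=> H; apply: (@eq_spl_in predT); rewrite ?all_predT // => l1 l2 _ _; apply: H. Qed.

Lemma eq_spl l Phi Psi :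
  (forall l1 l2, Phi l1 l2 = Psi l1 l2) -> spl l Phi = spl l Psi.
Proof. by move=> H; apply: eq_spl_dg. Qed.

Lemma spl_closed (P : W -> Prop) (h : pred X) l Phi :
  (forall a b, P a -> P b -> P (a + b)) -> (forall z a, P a -> P (sg z *: a)) ->
  all h l ->
  (forall l1 l2, all h l1 -> all h l2 -> (size l1 + size l2 = size l)%N ->
      dg l1 + dg l2 = dg l -> P (Phi l1 l2)) ->
  P (spl l Phi).
Proof. by move=> PD PZ; apply: (@spl_ind2 (fun a _ => P a)) => *; auto. Qed.

Lemma splD l Phi Psi :
  spl l (fun l1 l2 => Phi l1 l2 + Psi l1 l2) = spl l Phi + spl l Psi.
Proof.
elim: l Phi Psi => //= x l IH Phi Psi; rewrite IH -!addrA; congr (_ + _).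
rewrite [RHS]addrCA; congr (_ + _); rewrite -IH.
by apply: eq_spl => l1 l2; rewrite scalerDr.
Qed.

Lemma splZ l a Phi : spl l (fun l1 l2 => a *: Phi l1 l2) = a *: spl l Phi.
Proof.
elim: l Phi => //= x l IH Phi; rewrite IH scalerDr; congr (_ + _); rewrite -IH.
by apply: eq_spl => l1 l2; rewrite !scalerA mulrC.
Qed.

Lemma spl0 l : spl l (fun _ _ => 0 : W) = 0.
Proof. by elim: l => //= x l IH; rewrite IH add0r -[RHS]IH; apply: eq_spl => *; rewrite scaler0. Qed.

Lemma spl_sum l I (r : seq I) (P : pred I) (F : I -> seq X -> seq X -> W) :
  spl l (fun l1 l2 => \sum_(i <- r | P i) F i l1 l2) = \sum_(i <- r | P i) spl l (F i).
Proof.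
elim: r => [|i r IH].
  by rewrite big_nil -[RHS](spl0 l); apply: eq_spl => *; rewrite big_nil.
rewrite big_cons -IH; case: ifP => Pi; last by apply: eq_spl => *; rewrite big_cons Pi.
by rewrite -splD; apply: eq_spl => *; rewrite big_cons Pi.
Qed.

(** Counit law. It is mostly used from right to left, to present an isolated term as a sum over
    unshuffles that merges with another one. *)
Lemma spl_nill l (F : seq X -> W) :
  spl l (fun l1 l2 => if nilp l1 then F l2 else 0) = F l.
Proof.
elim: l F => //= x l IH F; rewrite (IH (fun l => F (x :: l))).
by rewrite -[RHS]addr0; congr (_ + _); rewrite -[RHS](spl0 l); apply: eq_spl => *; rewrite scaler0.
Qed.

Lemma spl_comm l Phi :
  spl l Phi = spl l (fun l1 l2 => sg (dg l1 * dg l2) *: Phi l2 l1).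
Proof.
elim: l Phi => /= [|x l IH] Phi; first by rewrite dg_nil ksign0 scale1r.
rewrite [RHS]addrC; congr (_ + _); rewrite IH;
  apply: eq_spl => l1 l2; rewrite !scalerA -!ksignD ?dg_cons; congr (_ *: _).
  by apply: (@ksign_mod2 _ (- (x.1 * dg l2))); ring.
by apply: (@ksign_mod2 _ 0); ring.
Qed.

Lemma spl_nilr l (F : seq X -> W) :
  spl l (fun l1 l2 => if nilp l2 then F l1 else 0) = F l.
Proof.
rewrite spl_comm -[RHS](spl_nill l); apply: eq_spl => [[|x l1]] l2 /=.
  by rewrite dg_nil mul0r scale1r.
by rewrite scaler0.
Qed.

(** Coassociativity of the unshuffle coproduct: both sides sum over the unshuffles into three
    blocks. *)
Lemma spl_assoc l (Phi : seq X -> seq X -> seq X -> W) :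
  spl l (fun l1 l2 => spl l1 (fun a b => Phi a b l2))
  = spl l (fun l1 l2 => spl l2 (fun b c => Phi l1 b c)).
Proof.
elim: l Phi => //= x l IH Phi.
rewrite [X in _ + X = _](@eq_spl l _ (fun l1 l2 =>
     sg (x.1 * dg l2) *: spl l1 (fun a b => Phi a (x :: b) l2)
   + sg (x.1 * dg l2) *: spl l1 (fun a b => sg (x.1 * dg b) *: Phi (x :: a) b l2))); last first.
  by move=> l1 l2; rewrite scalerDr.
rewrite !splD !addrA; congr (_ + _ + _).
- exact: (IH (fun a b c => Phi a b (x :: c))).
- by rewrite -IH; apply: eq_spl => l1 l2; rewrite -splZ.
under eq_spl do rewrite -splZ.
rewrite (IH (fun a b c => sg (x.1 * dg c) *: (sg (x.1 * dg b) *: Phi (x :: a) b c))).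
apply: eq_spl => l1 l2; rewrite -splZ; apply: eq_spl_dg => a b _ <-.
by rewrite scalerA -ksignD; congr (sg _ *: _); ring.
Qed.

End SplTheory.

Lemma spl_lin (W W' : lmodType K) (f : W -> W') l Phi : lin f ->
  f (spl l Phi) = spl l (fun l1 l2 => f (Phi l1 l2)).
Proof.
move=> Lf; elim: l Phi => //= x l IH Phi; rewrite linD // !IH; congr (_ + _).
by apply: eq_spl => *; rewrite linZ.
Qed.

(* The unshuffles into [p] blocks; [Phi] receives the last block first. *)
Fixpoint csum (W : lmodType K) p (l : seq X) (Phi : seq (seq X) -> W) : W :=
  if p is p'.+1 then spl l (fun l1 l2 => csum p' l1 (fun bs => Phi (l2 :: bs)))
  else if nilp l then Phi [::] else 0.

Lemma eq_csum (W : lmodType K) p l (Phi Psi : seq (seq X) -> W) :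
  (forall bs, Phi bs = Psi bs) -> csum p l Phi = csum p l Psi.
Proof.
elim: p l Phi Psi => [|p IH] l Phi Psi H /=; first by rewrite H.
by apply: eq_spl => l1 l2; apply: IH.
Qed.

Lemma csum0 (W : lmodType K) p l : csum p l (fun _ => 0 : W) = 0.
Proof.
by elim: p l => [|p IH] l /=; rewrite ?if_same // -[RHS](spl0 W l); apply: eq_spl.
Qed.

Lemma csumZ (W : lmodType K) p l a (Phi : seq (seq X) -> W) :
  csum p l (fun bs => a *: Phi bs) = a *: csum p l Phi.
Proof.
elim: p l Phi => [|p IH] l Phi /=; first by case: nilp; rewrite ?scaler0.
by rewrite -splZ; apply: eq_spl.
Qed.

Lemma csum_nil (W : lmodType K) p (Phi : seq (seq X) -> W) :
  csum p [::] Phi = Phi (nseq p [::]).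
Proof. by elim: p Phi => //= p IH Phi; rewrite IH. Qed.

Lemma csum1 (W : lmodType K) l (Phi : seq (seq X) -> W) : csum 1 l Phi = Phi [:: l].
Proof. by rewrite -(spl_nill l (fun l => Phi [:: l])). Qed.

Definition consat (x : X) i (bs : seq (seq X)) :=
  set_nth [::] bs i (x :: nth [::] bs i).

(** The last input [x] enters some block [i] and crosses the blocks to its right, which come earlier
    in [bs]. This is the recursion that colourings satisfy when the last input is added. *)
Lemma csum_cons (W : lmodType K) p x l (Phi : seq (seq X) -> W) :
  csum p (x :: l) Phi = \sum_(i < p)
    csum p l (fun bs => sg (x.1 * \sum_(m < i) dg (nth [::] bs m)) *: Phi (consat x i bs)).
Proof.
elim: p l Phi => [|p IH] l Phi /=; first by rewrite big_ord0.
rewrite big_ord_recl /=; congr (_ + _).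
  apply: eq_spl => l1 l2; apply: eq_csum => bs.
  by rewrite big_ord0 mulr0 scale1r.
rewrite -spl_sum; apply: eq_spl => l1 l2; rewrite IH scaler_sumr.
apply: eq_bigr => i _; rewrite -csumZ; apply: eq_csum => bs.
by rewrite scalerA -ksignD big_ord_recl mulrDr.
Qed.

End Splits.

(** * Colourings as iterated unshuffles *)

Section Colourings.
Variables (K : fieldType) (V : Type) (s : int).
Notation sg := (ksign K).
Notation X := (int * V)%type.

Definition shp n (x : 'I_n -> V) (d : 'I_n -> int) (a : 'I_n) : X := (d a + s, x a).

Lemma map_snd_lst n (x : 'I_n -> V) d : map snd (lst (shp x d)) = lst x.
Proof. by rewrite /lst -map_comp; apply: eq_map. Qed.

Lemma map_snd_blk n p (x : 'I_n -> V) d (c : 'I_n -> 'I_p) j :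
  map snd (blk (shp x d) c j) = blk x c j.
Proof. by rewrite /blk -map_comp; apply: eq_map. Qed.

Lemma lst_surj (l : seq X) : exists n (x : 'I_n -> V) d, l = lst (shp x d).
Proof.
pose f (a : 'I_(size l)) := tnth (in_tuple l) a.
exists (size l), (fun a => (f a).2), (fun a => (f a).1 - s).
rewrite -[LHS](map_tnth_enum (in_tuple l)); apply: eq_map => a.
by rewrite /shp subrK -surjective_pairing.
Qed.

Lemma size_lst T n (x : 'I_n -> T) : size (lst x) = n.
Proof. by rewrite size_map size_enum_ord. Qed.

Lemma dg_lst n (x : 'I_n -> V) d : dg (lst (shp x d)) = \sum_(a < n) (d a + s).
Proof. by rewrite /dg big_map big_enum. Qed.

Lemma nilp_blk T n p (x : 'I_n -> T) (c : 'I_n -> 'I_p) j :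
  nilp (blk x c j) = ~~ [exists a, c a == j].
Proof.
rewrite /nilp size_map size_filter -leqn0 leqNgt -has_count -all_predC.
apply/allP/existsPn => [H a|H a _]; last exact: H.
by apply: H; rewrite mem_enum.
Qed.

Lemma dg_blk n p (x : 'I_n -> V) d (c : 'I_n -> 'I_p) j :
  dg (blk (shp x d) c j) = \sum_(a < n | c a == j) (d a + s).
Proof. by rewrite /dg /blk big_map big_filter big_enum_cond. Qed.

(** Reversed among the blocks and inside each of them, to agree with [csum], which has the last
    block first and the last input of a block at its head. *)
Definition rblks n p (x : 'I_n -> V) d (c : 'I_n -> 'I_p) : seq (seq X) :=
  rev [seq rev (blk (shp x d) c j) | j <- enum 'I_p].

Definition colext n p (q : {ffun 'I_n -> 'I_p} * 'I_p) : {ffun 'I_n.+1 -> 'I_p} :=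
  [ffun a => if unlift ord_max a is Some b then q.1 b else q.2].

Lemma widen_lift n (a : 'I_n) : widen_ord (leqnSn n) a = lift ord_max a.
Proof. by apply: ord_inj; rewrite lift_max. Qed.

Lemma colext_widen n p q (a : 'I_n) : @colext n p q (widen_ord (leqnSn n) a) = q.1 a.
Proof. by rewrite ffunE widen_lift liftK. Qed.

Lemma colext_max n p q : @colext n p q ord_max = q.2.
Proof. by rewrite ffunE unlift_none. Qed.

Lemma sum_colext (W : lmodType K) n p (F : {ffun 'I_n.+1 -> 'I_p} -> W) :
  \sum_c F c = \sum_(c : {ffun 'I_n -> 'I_p}) \sum_(j < p) F (colext (c, j)).
Proof.
rewrite pair_big /= (reindex (@colext n p)); last first.
  exists (fun c : {ffun 'I_n.+1 -> 'I_p} => ([ffun a : 'I_n => c (lift ord_max a)], c ord_max)) => [[c j]|c] _ /=.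
    rewrite colext_max; congr pair; apply/ffunP => a.
    by rewrite ffunE -widen_lift colext_widen.
  apply/ffunP => a; rewrite ffunE; case: unliftP => [b ->|->] //=.
  by rewrite ffunE.
by apply: eq_bigr => [[c j]].
Qed.

Lemma blk_colext T n p (x : 'I_n.+1 -> T) (c : {ffun 'I_n -> 'I_p}) j i :
  blk x (colext (c, j)) i =
  let b := blk (fun a => x (widen_ord (leqnSn n) a)) c i in
  if j == i then rcons b (x ord_max) else b.
Proof.
rewrite /blk enum_ordSr filter_rcons colext_max /= filter_map.
rewrite (@eq_filter _ _ (fun a => c a == i)); last by move=> a /=; rewrite colext_widen.
by case: (j == i); rewrite ?map_rcons -map_comp.
Qed.

Lemma kcol_colext n p d (c : {ffun 'I_n -> 'I_p}) (j : 'I_p) :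
  kcol K s d (colext (c, j)) = kcol K s (fun a => d (widen_ord (leqnSn n) a)) c *
   sg ((d ord_max + s) * \sum_(a < n | (j < c a)%N) (d (widen_ord (leqnSn n) a) + s)).
Proof.
rewrite /kcol big_ord_recr /= [X in _ * X]big1 ?mulr1; last first.
  by move=> b /andP[]; rewrite ltnNge -ltnS ltn_ord.
rewrite mulr_sumr ksign_sum [X in _ * X]big_mkcond -big_split /=.
apply: eq_bigr => a _; rewrite big_mkcond big_ord_recr /= colext_max colext_widen /=.
rewrite -big_mkcond /= ltn_ord /=; congr (_ * _); last by case: ifP; rewrite // mulrC.
rewrite big_mkcond [RHS]big_mkcond; apply: eq_bigr => b _.
by rewrite colext_widen.
Qed.

Lemma nth_rblks n p (x : 'I_n -> V) d (c : 'I_n -> 'I_p) (m : 'I_p) :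
  nth [::] (rblks x d c) m = rev (blk (shp x d) c (rev_ord m)).
Proof.
rewrite nth_rev size_map size_enum_ord // (nth_map m) ?size_enum_ord.
  by congr (rev (blk _ _ _)); apply: val_inj; rewrite /= nth_enum_ord // ltn_subrL /= (leq_ltn_trans _ (ltn_ord m)).
by rewrite ltn_subrL /= (leq_ltn_trans _ (ltn_ord m)).
Qed.

Lemma size_rblks n p (x : 'I_n -> V) d (c : 'I_n -> 'I_p) : size (rblks x d c) = p.
Proof. by rewrite size_rev size_map size_enum_ord. Qed.

Lemma sum_kcolE (W : lmodType K) p n (x : 'I_n -> V) d (Phi : seq (seq X) -> W) :
  \sum_(c : {ffun 'I_n -> 'I_p}) kcol K s d c *: Phi (rblks x d c)
  = csum p (rev (lst (shp x d))) Phi.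
Proof.
elim: n x d Phi => [|n IH] x d Phi.
  have -> : lst (shp x d) = [::] by rewrite /lst enum_ord0.
  have cu c : c = [ffun a : 'I_0 => False_rect 'I_p (notF (valP a))] :> {ffun 'I_0 -> 'I_p}.
    by apply/ffunP => -[].
  rewrite csum_nil (bigD1 [ffun a : 'I_0 => False_rect 'I_p (notF (valP a))]) //=.
  rewrite big1 => [|c]; last by rewrite [c]cu eqxx.
  rewrite addr0 /kcol big_ord0 scale1r; congr Phi.
  apply: (@eq_from_nth _ [::]) => [|i]; first by rewrite size_rblks size_nseq.
  rewrite size_rblks => ip; rewrite nth_nseq ip (nth_rblks _ _ _ (Ordinal ip)).
  by rewrite /blk enum_ord0.
set w := widen_ord (leqnSn n).
have -> : rev (lst (shp x d)) = shp x d ord_max :: rev (lst (shp (x \o w) (d \o w))).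
  by rewrite /lst enum_ordSr map_rcons rev_rcons -map_comp.
(* [csum] numbers the blocks from the last one, colourings from the first; [rev_ord] translates the
   colour of the new input. *)
rewrite csum_cons sum_colext exchange_big (reindex_inj rev_ord_inj) /=.
apply: eq_bigr => i _; rewrite -IH; apply: eq_bigr => c _.
rewrite kcol_colext scalerA; congr (_ * sg (_ * _) *: Phi _).
  apply: esym; rewrite (big_ord_widen p (fun m => dg (nth [::] (rblks (x \o w) (d \o w) c) m))) 1?ltnW //.
  under eq_bigr do rewrite nth_rblks dg_rev dg_blk.
  rewrite (exchange_big_dep predT) //= [RHS]big_mkcond; apply: eq_bigr => a _.
  have E (m : 'I_p) : (m < i)%N && (c a == rev_ord m) = (rev_ord i < c a)%N && (m == rev_ord (c a)).
    rewrite -val_eqE -[m == _]val_eqE /=; have := ltn_ord m; have := ltn_ord i.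
    by have := ltn_ord (c a); lia.
  case: ifP => H.
    by rewrite (big_pred1 (rev_ord (c a))) // => m; rewrite E H.
  by rewrite big_pred0 // => m; rewrite E H.
apply: (@eq_from_nth _ [::]) => [|m]; rewrite size_rblks.
  by rewrite size_set_nth size_rblks; apply/esym/maxn_idPr; rewrite ltn_ord.
move=> mp; rewrite nth_set_nth /= !(nth_rblks _ _ _ (Ordinal mp)) blk_colext /= nth_rblks.
have -> : (rev_ord i == rev_ord (Ordinal mp)) = (m == i).
  by rewrite (inj_eq rev_ord_inj) eq_sym.
case: eqP => // mi; rewrite rev_rcons; congr (_ :: rev (blk _ _ _)).
by apply: val_inj; rewrite /= mi.
Qed.

Lemma sum_kcol2E (W : lmodType K) n (x : 'I_n -> V) d (Phi : seq X -> seq X -> W) :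
  \sum_(c : {ffun 'I_n -> 'I_2}) kcol K s d c *:
     Phi (rev (blk (shp x d) c ord0)) (rev (blk (shp x d) c ord_max))
  = spl (rev (lst (shp x d))) Phi.
Proof.
transitivity (spl (rev (lst (shp x d)))
    (fun l1 l2 => csum 1 l1 (fun bs => Phi (head [::] bs) l2))); last first.
  by apply: eq_spl => l1 l2; rewrite csum1.
rewrite -[RHS]/(csum 2 (rev (lst (shp x d))) (fun bs => Phi (head [::] (behead bs)) (head [::] bs))).
rewrite -sum_kcolE; apply: eq_bigr => c _.
have -> : rblks x d c = [:: rev (blk (shp x d) c ord_max); rev (blk (shp x d) c ord0)].
  rewrite /rblks enum_ordSr enum_ordSr enum_ord0 /=.
  by congr [:: rev (blk _ _ _); rev (blk _ _ _)]; apply: val_inj.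
by [].
Qed.

End Colourings.

(** * Graded symmetry and sums over set partitions *)

Section Symmetry.
Variables (K : fieldType) (V : Type) (h : pred (int * V)).
Notation X := (int * V)%type.
Notation sg := (ksign K).

(** The bound on the size allows symmetry of the transferred morphism to be proved by induction on
    the number of inputs. *)
Definition gsymn (W : lmodType K) n (Phi : seq X -> W) :=
  forall us v u ws, all h (us ++ v :: u :: ws) ->
    (size (us ++ v :: u :: ws) <= n)%N ->
    Phi (us ++ v :: u :: ws) = sg (u.1 * v.1) *: Phi (us ++ u :: v :: ws).

Lemma dg_cat (l1 l2 : seq X) : dg (l1 ++ l2) = dg l1 + dg l2.
Proof. exact: big_cat. Qed.

Lemma dg_swap us (v u : X) ws : dg (us ++ v :: u :: ws) = dg (us ++ u :: v :: ws).
Proof. by rewrite !dg_cat !dg_cons; ring. Qed.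

Lemma spl_gsym (W : lmodType K) (Phi : seq X -> seq X -> W) us v u ws :
  all h (us ++ v :: u :: ws) ->
  (forall l us' ws', all h l -> all h (us' ++ v :: u :: ws') ->
     (size l + size (us' ++ v :: u :: ws') = size (us ++ v :: u :: ws))%N ->
     Phi l (us' ++ v :: u :: ws') = sg (u.1 * v.1) *: Phi l (us' ++ u :: v :: ws') /\
     Phi (us' ++ v :: u :: ws') l = sg (u.1 * v.1) *: Phi (us' ++ u :: v :: ws') l) ->
  spl (us ++ v :: u :: ws) Phi = sg (u.1 * v.1) *: spl (us ++ u :: v :: ws) Phi.
Proof.
elim: us Phi => [|x us IH] Phi /=; last first.
  move=> /andP[hx hl] H; rewrite IH //; last first.
    move=> l us' ws' al all' sz; split.
      by case: (H l (x :: us') ws' al) => //=; rewrite ?hx // addnS sz.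
    by case: (H (x :: l) us' ws') => //=; rewrite ?hx // addSn sz.
  rewrite scalerDr; congr (_ + _).
  rewrite IH // => l us' ws' al all' sz; rewrite !scalerA ![sg (u.1 * v.1) * _]mulrC -!scalerA; split.
    rewrite dg_swap; congr (_ *: _).
    by case: (H (x :: l) us' ws') => //=; rewrite ?hx // addSn sz.
  by congr (_ *: _); case: (H l (x :: us') ws' al) => //=; rewrite ?hx // addnS sz.
move=> /and3P[hv hu hws] H.
rewrite !scalerDr -!splZ -!splD; apply: (eq_spl_in hws) => l1 l2 h1 h2 sz _ /=.
have [|||-> _] := H l1 [::] l2; rewrite /= ?hv ?hu //; first by rewrite !addnS sz.
have [|||_ ->] := H l2 [::] l1; rewrite /= ?hv ?hu //; first by rewrite !addnS addnC sz.
rewrite !scalerA -!ksignD !dg_cons -!addrA; congr (_ + _).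
rewrite [LHS]addrCA; congr (_ *: _ + (_ *: _ + _ *: _)).
- by apply: ksign_mod2 0 _ _ _; ring.
- by apply: ksign_mod2 (- (u.1 * v.1)) _ _ _; ring.
by apply: ksign_mod2 0 _ _ _; ring.
Qed.

Lemma gsym_move (W : lmodType K) (Phi : seq X -> W) us y ws :
  (forall n, gsymn n Phi) -> all h (us ++ y :: ws) ->
  Phi (us ++ y :: ws) = sg (y.1 * dg us) *: Phi (y :: us ++ ws).
Proof.
move=> S; elim/last_ind: us ws => [|us u IH] ws.
  by rewrite dg_nil mulr0 scale1r.
rewrite !cat_rcons => H; rewrite (S _ _ _ _ _ H (leqnn _)) IH; last first.
  by move: H; rewrite !all_cat /= => /and4P[-> -> -> ->].
rewrite scalerA -ksignD; congr (sg _ *: _).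
by rewrite -cats1 dg_cat dg_cons dg_nil; ring.
Qed.
End Symmetry.

(** * Sums over unordered and ordered set partitions *)

Section Partitions.
Variables (K : fieldType) (V : Type) (U : lmodType K) (t : seq (int * V) -> U).
Notation X := (int * V)%type.
Notation Y := (int * U)%type.
Notation sg := (ksign K).

(** The value on a block keeps the total degree of the block, as befits a map of degree 0 for
    shifted degrees. *)
Definition tp (l : seq X) : Y := (dg l, t l).

(* Unordered partitions of [l] into [p] blocks, each block [b] being replaced
   by [tp b]: the block of the last input is chosen first, then the rest is
   partitioned.  No factorials occur, contrary to the ordered sums [cb]. *)
Fixpoint ptp (W : lmodType K) p (l : seq X) (Phi : seq Y -> W) : W :=
  match p, l with
  | 0, [::] => Phi [::]
  | p'.+1, y :: l' =>
      spl l' (fun l1 l2 => ptp p' l1 (fun bs => Phi (tp (y :: l2) :: bs)))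
  | _, _ => 0
  end.

Definition pt (W : lmodType K) (l : seq X) (Phi : seq Y -> W) : W :=
  \sum_(p < (size l).+1) ptp p l Phi.

Lemma ptp_gt (W : lmodType K) p l (Phi : seq Y -> W) : (size l < p)%N -> ptp p l Phi = 0.
Proof.
elim: p l Phi => [|p IH] [|y l] Phi //= lp; rewrite -[RHS](spl0 W l).
by apply: eq_spl_dg => l1 l2 sz _; rewrite IH //; lia.
Qed.

Lemma sum_ptp (W : lmodType K) n l (Phi : seq Y -> W) :
  (size l <= n)%N -> \sum_(p < n.+1) ptp p l Phi = pt l Phi.
Proof.
move=> ln; rewrite /pt [RHS](big_ord_widen n.+1 (fun p => ptp p l Phi)) //.
rewrite [RHS]big_mkcond; apply: eq_bigr => p _; case: ltnP => // lp.
by rewrite ptp_gt.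
Qed.

Lemma pt_nil (W : lmodType K) (Phi : seq Y -> W) : pt [::] Phi = Phi [::].
Proof. by rewrite /pt big_ord1. Qed.

Lemma pt_cons (W : lmodType K) y l (Phi : seq Y -> W) :
  pt (y :: l) Phi = spl l (fun l1 l2 => pt l1 (fun bs => Phi (tp (y :: l2) :: bs))).
Proof.
rewrite /pt big_ord_recl add0r -spl_sum; apply: eq_spl_dg => l1 l2 sz _.
by apply: sum_ptp; rewrite -/(size l) -sz leq_addr.
Qed.

Lemma eq_pt_in (h : pred X) (h' : pred Y) (W : lmodType K) l (Phi Psi : seq Y -> W) :
  (forall l', all h l' -> ~~ nilp l' -> h' (tp l')) -> all h l ->
  (forall bs, all h' bs -> dg bs = dg l -> nilp bs = nilp l -> Phi bs = Psi bs) ->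
  pt l Phi = pt l Psi.
Proof.
move=> Ht; have [n] := ubnP (size l); elim: n l Phi Psi => // n IH [|y l] Phi Psi /=.
  by move=> _ _ H; rewrite !pt_nil H // !dg_nil.
move=> ln /andP[hy hl] H; rewrite !pt_cons; apply: (eq_spl_in hl) => l1 l2 h1 h2 sz ds.
apply: IH => //; first by lia.
move=> bs hbs dbs _; apply: H => //=; first by rewrite hbs Ht //= hy.
by rewrite !dg_cons /= dg_cons dbs -ds; ring.
Qed.

Lemma eq_pt_nilp (W : lmodType K) l (Phi Psi : seq Y -> W) :
  (forall bs, dg bs = dg l -> nilp bs = nilp l -> Phi bs = Psi bs) -> pt l Phi = pt l Psi.
Proof.
move=> H; apply: (@eq_pt_in predT predT) => //; first by rewrite all_predT.
by move=> bs _; apply: H.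
Qed.

Lemma eq_pt (W : lmodType K) l (Phi Psi : seq Y -> W) :
  (forall bs, Phi bs = Psi bs) -> pt l Phi = pt l Psi.
Proof. by move=> H; apply: eq_pt_nilp. Qed.

Lemma pt_lin (W W' : lmodType K) (f : W -> W') l (Phi : seq Y -> W) : lin f ->
  f (pt l Phi) = pt l (fun bs => f (Phi bs)).
Proof.
move=> Lf; have [n] := ubnP (size l); elim: n l Phi => // n IH [|y l] Phi /= ln.
  by rewrite !pt_nil.
rewrite !pt_cons spl_lin //; apply: eq_spl_dg => l1 l2 sz _; apply: IH; lia.
Qed.

Lemma ptZ (W : lmodType K) l a (Phi : seq Y -> W) :
  pt l (fun bs => a *: Phi bs) = a *: pt l Phi.
Proof.
rewrite (@pt_lin W W ( *:%R a)) // => c u v.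
by rewrite scalerDr !scalerA mulrC.
Qed.

Lemma ptD (W : lmodType K) l (Phi Psi : seq Y -> W) :
  pt l (fun bs => Phi bs + Psi bs) = pt l Phi + pt l Psi.
Proof.
have [n] := ubnP (size l); elim: n l Phi Psi => // n IH [|y l] Phi Psi /= ln.
  by rewrite !pt_nil.
rewrite !pt_cons -splD; apply: eq_spl_dg => l1 l2 sz _; apply: IH; lia.
Qed.

Lemma pt0 (W : lmodType K) l : pt l (fun _ => 0 : W) = 0.
Proof. by rewrite -[RHS](scale0r (pt l (fun _ => 0))) -ptZ; apply: eq_pt => bs; rewrite scaler0. Qed.

Lemma pt_closed (h : pred X) (h' : pred Y) (W : lmodType K) (P : W -> Prop) l
    (Phi : seq Y -> W) :
  (forall a b, P a -> P b -> P (a + b)) -> (forall z a, P a -> P (sg z *: a)) ->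
  (forall l', all h l' -> ~~ nilp l' -> h' (tp l')) -> all h l ->
  (forall bs, all h' bs -> dg bs = dg l -> nilp bs = nilp l -> P (Phi bs)) ->
  P (pt l Phi).
Proof.
move=> PD PZ Ht; have [n] := ubnP (size l); elim: n l Phi => // n IH [|y l] Phi /=.
  by move=> _ _ H; rewrite !pt_nil; apply: H; rewrite ?dg_nil.
move=> ln /andP[hy hl] H; rewrite !pt_cons.
apply: (spl_closed (h := h)) => // l1 l2 h1 h2 sz ds.
apply: IH => //; first by lia.
move=> bs hbs dbs _; apply: H => //=; first by rewrite hbs Ht //= hy.
by rewrite !dg_cons /= dg_cons dbs -ds; ring.
Qed.

Lemma pt_spl_exch (W : lmodType K) V' l l' (Phi : seq Y -> seq (int * V') -> seq (int * V') -> W) :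
  pt l (fun bs => spl l' (Phi bs)) = spl l' (fun a b => pt l (fun bs => Phi bs a b)).
Proof.
elim: l' Phi => //= x l' IH Phi; rewrite ptD IH; congr (_ + _); rewrite IH.
by apply: eq_spl => *; rewrite ptZ.
Qed.

(* Two-colouring the blocks of a partition of [l] amounts to splitting [l] in
   two and partitioning each half. *)
Lemma pt_spl (W : lmodType K) l (Psi : seq Y -> seq Y -> W) :
  pt l (fun bs => spl bs Psi)
  = spl l (fun l1 l2 => pt l1 (fun a1 => pt l2 (fun a2 => Psi a1 a2))).
Proof.
have [n] := ubnP (size l); elim: n l Psi => // n IH [|y l] Psi /= ln.
  by rewrite !pt_nil.
rewrite pt_cons /=.
transitivity (spl l (fun l1 l2 =>
    spl l1 (fun m1 m2 => pt m1 (fun a1 => pt m2 (fun a2 => Psi a1 (tp (y :: l2) :: a2))))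
  + spl l1 (fun m1 m2 => pt m1 (fun a1 => pt m2 (fun a2 =>
       sg (dg (y :: l2) * dg a2) *: Psi (tp (y :: l2) :: a1) a2))))).
  by apply: eq_spl_dg => l1 l2 sz _; rewrite ptD !IH //; lia.
rewrite splD; congr (_ + _).
  rewrite (spl_assoc l (fun m1 m2 l2 => pt m1 (fun a1 => pt m2 (fun a2 => Psi a1 (tp (y :: l2) :: a2))))).
  apply: eq_spl => l1 l2; rewrite -pt_spl_exch; apply: eq_pt => bs.
  by rewrite pt_cons.
pose F m1 m2 m3 : W := pt m1 (fun a1 => pt m3 (fun a2 => Psi (tp (y :: m2) :: a1) a2)).
transitivity (spl l (fun l1 l2 => spl l1 (fun m1 m2 =>
   sg (dg (y :: l2) * dg m2) *: F m1 l2 m2))).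
  apply: eq_spl => l1 l2; apply: eq_spl => m1 m2; rewrite /F -ptZ; apply: eq_pt => a1.
  by rewrite -ptZ; apply: eq_pt_nilp => a2 -> _.
rewrite (spl_assoc l (fun m1 m2 l2 => sg (dg (y :: l2) * dg m2) *: F m1 l2 m2)).
transitivity (spl l (fun l1 l2 => spl l2 (fun b c => sg (y.1 * dg c) *: F l1 b c))).
  apply: eq_spl => m1 l2; rewrite spl_comm; apply: eq_spl => a b.
  rewrite scalerA -ksignD; congr (_ *: _).
  by rewrite dg_cons; apply: ksign_mod2 (dg a * dg b) _ _ _; ring.
rewrite -(spl_assoc l (fun a b c => sg (y.1 * dg c) *: F a b c)); apply: eq_spl => l1 l2.
by rewrite splZ; congr (_ *: _); rewrite pt_cons.
Qed.

(* Ordered partitions of [l] into [p] nonempty blocks. *)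
Fixpoint cb (W : lmodType K) p (l : seq X) (Phi : seq Y -> W) : W :=
  if p is p'.+1 then
    spl l (fun l1 l2 => if nilp l2 then 0 else cb p' l1 (fun bs => Phi (tp l2 :: bs)))
  else if nilp l then Phi [::] else 0.

Lemma eq_cb (W : lmodType K) p l (Phi Psi : seq Y -> W) :
  (forall bs, Phi bs = Psi bs) -> cb p l Phi = cb p l Psi.
Proof.
elim: p l Phi Psi => [|p IH] l Phi Psi H /=; first by rewrite H.
by apply: eq_spl => l1 l2; case: ifP => // _; apply: IH.
Qed.

Lemma cbZ (W : lmodType K) p l a (Phi : seq Y -> W) :
  cb p l (fun bs => a *: Phi bs) = a *: cb p l Phi.
Proof.
elim: p l Phi => [|p IH] l Phi /=; first by case: nilp; rewrite ?scaler0.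
by rewrite -splZ; apply: eq_spl => *; case: ifP => _; rewrite ?scaler0.
Qed.

Lemma cb_closed (h : pred X) (h' : pred Y) (W : lmodType K) (P : W -> Prop) p l
    (Phi : seq Y -> W) :
  P 0 -> (forall a b, P a -> P b -> P (a + b)) -> (forall z a, P a -> P (sg z *: a)) ->
  all h l ->
  (forall l', all h l' -> ~~ nilp l' -> (size l' <= size l)%N -> h' (tp l')) ->
  (forall bs, all h' bs -> dg bs = dg l -> P (Phi bs)) -> P (cb p l Phi).
Proof.
move=> P0 PD PZ; elim: p l Phi => [|p IH] l Phi hl Ht H /=.
  by case: nilP => // l0; apply: H; rewrite // l0 !dg_nil.
apply: (spl_closed (h := h)) => // l1 l2 h1 h2 sz ds; case: ifP => // /negbT n2.
apply: IH => // [l' hl' nl' sl'|bs hb db]; first by apply: Ht => //; lia.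
apply: H => /=; first by rewrite hb Ht //; lia.
by rewrite dg_cons db -ds addrC.
Qed.

Lemma eq_ptp (W : lmodType K) p l (Phi Psi : seq Y -> W) :
  (forall bs, Phi bs = Psi bs) -> ptp p l Phi = ptp p l Psi.
Proof.
elim: p l Phi Psi => [|p IH] [|y l] Phi Psi H //=.
by apply: eq_spl => l1 l2; apply: IH.
Qed.

Lemma eq_ptpS (W : lmodType K) p l (Phi Psi : seq Y -> W) :
  (forall b bs, Phi (b :: bs) = Psi (b :: bs)) -> ptp p.+1 l Phi = ptp p.+1 l Psi.
Proof. by case: l => //= y l H; apply: eq_spl => *; apply: eq_ptp. Qed.

Lemma csum_cb (W : lmodType K) p l (Phi : seq Y -> W) :
  csum p l (fun bs => if all (fun b => ~~ nilp b) bs then Phi (map tp bs) else 0) = cb p l Phi.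
Proof.
elim: p l Phi => //= p IH l Phi; apply: eq_spl => l1 l2; case: (nilp l2) => /=.
  by rewrite csum0.
by rewrite -IH.
Qed.

Variables (h : pred X) (h' : pred Y).
Hypothesis tpP : forall l, all h l -> ~~ nilp l -> h' (tp l).

Definition gsym (W : lmodType K) (Phi : seq Y -> W) :=
  forall us v u ws, h' u -> h' v ->
    Phi (us ++ v :: u :: ws) = sg (u.1 * v.1) *: Phi (us ++ u :: v :: ws).

Lemma gsym_cons (W : lmodType K) (Phi : seq Y -> W) b :
  gsym Phi -> gsym (fun bs => Phi (b :: bs)).
Proof. by move=> S us v u ws hu hv; apply: (S (b :: us)). Qed.

(** The block containing [y] may stand at any of [p.+1] positions, and symmetry of [Phi] brings it
    to the head from each of them with the same contribution. *)
Lemma cb_cons (W : lmodType K) p y l (Phi : seq Y -> W) : gsym Phi -> all h (y :: l) ->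
  cb p.+1 (y :: l) Phi
  = p.+1%:R *: spl l (fun l1 l2 => cb p l1 (fun bs => Phi (tp (y :: l2) :: bs))).
Proof.
elim: p y l Phi => [|p IH] y l Phi S /= /andP[hy hl].
  rewrite scale1r -[RHS]addr0; congr (_ + _); rewrite -[RHS](spl0 W l).
  by apply: eq_spl => *; rewrite if_same scaler0.
rewrite -[p.+2%:R]nat1r scalerDl scale1r; congr (_ + _).
pose G l1 l2 l3 : W := if nilp l2 then 0
  else cb p l1 (fun bs => Phi (tp (y :: l3) :: tp l2 :: bs)).
transitivity (p.+1%:R *: spl l (fun l1 l3 => spl l1 (fun m1 m2 => G m1 m2 l3))); last first.
  by congr (_ *: _).
rewrite spl_assoc -splZ.
transitivity (spl l (fun l1 l2 => spl l1 (fun m1 m2 =>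
   p.+1%:R *: (sg (dg l2 * dg m2) *: G m1 l2 m2)))).
  apply: (eq_spl_in hl) => l1 l2 h1 h2 _ _; rewrite /G; case: (boolP (nilp l2)) => n2.
    by rewrite scaler0 -[LHS](spl0 W l1); apply: eq_spl => *; rewrite !scaler0.
  rewrite -[X in _ *: X = _]/(cb p.+1 (y :: l1) (fun bs => Phi (tp l2 :: bs))).
  rewrite IH; [|exact: gsym_cons|by rewrite /= hy]; rewrite scalerA mulrC -scalerA -splZ -splZ.
  apply: (eq_spl_in h1) => m1 m2 _ hm2 _ _; congr (_ *: _).
  have E bs : Phi (tp l2 :: tp (y :: m2) :: bs)
     = sg (dg (y :: m2) * dg l2) *: Phi (tp (y :: m2) :: tp l2 :: bs).
    by apply: (S [::]); apply: tpP => //=; rewrite hy.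
  rewrite (eq_cb _ _ E) cbZ scalerA -!ksignD; congr (_ *: _).
  by rewrite dg_cons; apply: ksign_mod2 (y.1 * dg l2) _ _ _; ring.
rewrite (spl_assoc l (fun m1 m2 l2 => p.+1%:R *: (sg (dg l2 * dg m2) *: G m1 l2 m2))).
apply: eq_spl => m1 l'; rewrite splZ; congr (_ *: _); rewrite [RHS]spl_comm.
by apply: eq_spl => a b; rewrite mulrC.
Qed.

(** This accounts for the factorials of the statement: 1/p! in the morphism relation, where all
    blocks are permuted, and 1/(p-1)! in the transfer, where the block with [y] is fixed. *)
Lemma cb_ptp (W : lmodType K) p l (Phi : seq Y -> W) : gsym Phi -> all h l ->
  cb p l Phi = p`!%:R *: ptp p l Phi.
Proof.
elim: p l Phi => [|p IH] [|y l] Phi S hl.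
- by rewrite scale1r.
- by rewrite /= scaler0.
- by rewrite /= scaler0.
rewrite cb_cons // factS natrM -scalerA; congr (_ *: _); rewrite /= -splZ.
case/andP: hl => hy hl; apply: (eq_spl_in hl) => l1 l2 h1 _ _ _.
by apply: IH => //; apply: gsym_cons.
Qed.

Definition mlZ (W : lmodType K) (Phi : seq Y -> W) :=
  forall us e (a : K) u ws, Phi (us ++ (e, a *: u) :: ws) = a *: Phi (us ++ (e, u) :: ws).

(* If [Phi] vanishes on singletons, the symmetry of [t] is only needed on
   shorter lists: this is what makes the induction for [t] itself work. *)
Lemma pt_gsym (W : lmodType K) n us v u ws (Phi : seq Y -> W) :
  gsymn h n t -> gsym Phi -> mlZ Phi -> all h (us ++ v :: u :: ws) ->
  (size (us ++ v :: u :: ws) <= n.+1)%N ->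
  (size (us ++ v :: u :: ws) <= n)%N \/ (forall b, Phi [:: b] = 0) ->
  pt (us ++ v :: u :: ws) Phi = sg (u.1 * v.1) *: pt (us ++ u :: v :: ws) Phi.
Proof.
move=> St; have [m] := ubnP (size (us ++ v :: u :: ws)).
elim: m us ws Phi => // m IH us ws Phi lm S ML hl ln Hn.
(* Case of [v] and [u] in one block: [St] applies unless the block exceeds [n] inputs, which forces
   it to be the only block, and there [Phi] vanishes. *)
have tblk y us' ws' l : all h (y ++ us' ++ v :: u :: ws') ->
   (size l + size (y ++ us' ++ v :: u :: ws') = size (us ++ v :: u :: ws))%N ->
   pt l (fun bs => Phi (tp (y ++ us' ++ v :: u :: ws') :: bs)) =
   sg (u.1 * v.1) *: pt l (fun bs => Phi (tp (y ++ us' ++ u :: v :: ws') :: bs)).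
  rewrite !catA => hy sz; rewrite -ptZ; apply: eq_pt_nilp => bs _ nbs.
  have E : (size (us ++ v :: u :: ws) <= n)%N || ~~ nilp l ->
      Phi (tp ((y ++ us') ++ v :: u :: ws') :: bs) =
      sg (u.1 * v.1) *: Phi (tp ((y ++ us') ++ u :: v :: ws') :: bs).
    move=> H; rewrite /tp dg_swap St //; first exact: (ML [::]).
    by move: H sz; case: (l) => [|? ?] /=; rewrite ?orbF ?orbT; lia.
  case: Hn => [ln'|P1]; first by rewrite E ?ln'.
  have [nl|nl] := boolP (nilp l); last by rewrite E ?nl ?orbT.
  by move: nbs; rewrite nl => /nilP ->; rewrite !P1 scaler0.
case: us => [|y us] /= in lm hl ln Hn tblk *.
  case/and3P: hl => hv hu hws; rewrite !pt_cons /= scalerDr; congr (_ + _).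
    rewrite -splZ; apply: (eq_spl_in hws) => l1 l2 h1 h2 sz _.
    by rewrite (tblk [::] [::]) //= ?hv ?hu //; lia.
  (* Case of [v] and [u] in different blocks: the two blocks are exchanged by the symmetry of [Phi],
     not of [t]. *)
  pose F b c m1 m2 m3 : W := pt m1 (fun bs => Phi (tp (b :: m3) :: tp (c :: m2) :: bs)).
  transitivity (spl ws (fun l1 l2 => spl l1 (fun m1 m2 => sg (u.1 * dg l2) *: F v u m1 m2 l2))).
    by apply: eq_spl => l1 l2; rewrite splZ pt_cons.
  transitivity (sg (u.1 * v.1) *:
     spl ws (fun l1 l2 => spl l1 (fun m1 m2 => sg (v.1 * dg l2) *: F u v m1 m2 l2))); last first.
    by congr (_ *: _); apply: eq_spl => l1 l2; rewrite splZ pt_cons.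
  rewrite (spl_assoc ws (fun m1 m2 l2 => sg (u.1 * dg l2) *: F v u m1 m2 l2)).
  rewrite (spl_assoc ws (fun m1 m2 l2 => sg (v.1 * dg l2) *: F u v m1 m2 l2)) -splZ.
  apply: (eq_spl_in hws) => m1 l' _ hl' _ _; rewrite spl_comm -splZ.
  apply: (eq_spl_in hl') => m2 m3 h2 h3 _ _.
  have -> : F v u m1 m3 m2 = sg (dg (u :: m3) * dg (v :: m2)) *: F u v m1 m2 m3.
    rewrite /F -ptZ; apply: eq_pt => bs.
    by apply: (S [::]); apply: tpP; rewrite //= ?hu ?hv.
  rewrite !scalerA -!ksignD !dg_cons; congr (_ *: _).
  by apply: ksign_mod2 (u.1 * dg m2 + dg m2 * dg m3) _ _ _; ring.
case/andP: hl => hy hl; rewrite !pt_cons; apply: (spl_gsym (h := h)) => // l us' ws' al all' sz; split.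
  by rewrite (tblk [:: y]) //= ?hy //; lia.
move: (sz); rewrite addnC => sz'; apply: IH => //; first by lia.
- exact: gsym_cons.
- by move=> us'' e a x ws''; rewrite (ML (tp (y :: l) :: us'')).
- by lia.
by left; lia.
Qed.

End Partitions.

(** * Homogeneous lists *)

Definition reval (V W : Type) (f : seq V -> W) (l : seq (int * V)) : W := f (rev (map snd l)).

Definition hpair (V : Type) (gr : int -> pred V) (s : int) : pred (int * V) :=
  fun q => gr (q.1 - s) q.2.

Section Graded.
Variables (K : fieldType) (V : lmodType K) (gr : int -> pred V).
Hypothesis Vgr : graded_space gr.
Notation sg := (ksign K).

Lemma gr_add i u v : gr i u -> gr i v -> gr i (u + v).
Proof. by case: Vgr => _ H _ _ hu hv; rewrite -[u]scale1r H. Qed.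

Lemma gr_zero i : gr i 0. Proof. by case: Vgr. Qed.

Lemma gr_scale i a u : gr i u -> gr i (a *: u).
Proof. by case: Vgr => _ H _ _ hu; rewrite -[_ *: u]addr0 H // gr_zero. Qed.

Lemma lin_eq_homog (W : lmodType K) (f g : V -> W) : lin f -> lin g ->
  (forall i v, gr i v -> f v = g v) -> forall v, f v = g v.
Proof.
move=> Lf Lg H v; case: Vgr => _ _ /(_ v)[r [hr ->]] _.
rewrite !lin_sum // big_seq [RHS]big_seq; apply: eq_bigr => q /(allP hr).
exact: H.
Qed.

Variable s : int.
Notation hpair := (hpair gr s).

Lemma homog_lst n (x : 'I_n -> V) d : homog gr x d -> all hpair (lst (shp s x d)).
Proof. by move=> H; apply/allP => q /mapP[a _ ->]; rewrite /hpair /= addrK; apply: H. Qed.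

Lemma lst_homog (l : seq (int * V)) : all hpair l ->
  exists n (x : 'I_n -> V) d, [/\ n = size l, homog gr x d & l = lst (shp s x d)].
Proof.
have [n [x [d ->]]] := lst_surj s l; move=> H; exists n, x, d; split => //.
  by rewrite size_lst.
move=> a; move/allP: H => /(_ (shp s x d a)); rewrite /hpair /= addrK; apply.
by apply: map_f; rewrite mem_enum.
Qed.

Lemma fr_lst (W : Type) (f : seq V -> W) n (x : 'I_n -> V) d :
  reval f (rev (lst (shp s x d))) = f (lst x).
Proof. by rewrite /reval map_rev revK map_snd_lst. Qed.

Lemma dg_shp n (x : 'I_n -> V) d :
  dg (rev (lst (shp s x d))) = \sum_(a < n) d a + n%:Z * s.
Proof.
by rewrite dg_rev dg_lst big_split /= sumr_const card_ord -mulr_natl natz.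
Qed.

Lemma multilin_eq0 (W : lmodType K) (F : seq V -> W) : multilin F ->
  (forall l, all hpair l -> F (map snd l) = 0) -> forall l, F l = 0.
Proof.
move=> MF H l; suff G hs : all hpair hs -> F (map snd hs ++ l) = 0 by apply: (G [::]).
elim: l hs => [|v l IH] hs hhs; first by rewrite cats0 H.
case: Vgr => _ _ /(_ v)[r [hr ->]] _.
have Lf : lin (fun u => F (map snd hs ++ u :: l)) by move=> a u w; apply: MF.
rewrite (lin_sum Lf) big_seq big1 // => q /(allP hr) hq.
have := IH (rcons hs (q.1 + s, q.2)); rewrite map_rcons cat_rcons; apply.
by rewrite all_rcons hhs /hpair /= addrK hq.
Qed.

Lemma fr_gsym k (W : lmodType K) (f : seq V -> W) : s = k - 1 -> shsym gr k f ->
  gsym hpair (reval f).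
Proof.
move=> sE S us v u ws hu hv; rewrite /reval !map_cat /= !rev_cat !rev_cons -!cats1 -!catA /=.
rewrite (S _ _ _ _ _ _ hv hu) sE; congr (sg _ *: _); ring.
Qed.

Lemma gsym_gsymn (W : lmodType K) (Phi : seq (int * V) -> W) n :
  gsym hpair Phi -> gsymn hpair n Phi.
Proof.
move=> S us v u ws; rewrite all_cat /= => /and4P[_ hv hu _] _.
exact: S.
Qed.

(** In [shsym] the surrounding inputs are arbitrary, while the recursion only controls homogeneous
    ones; multilinearity bridges the gap, on the left and then on the right. *)
Lemma shsym_gsymn k (W : lmodType K) (f : seq V -> W) : s = k - 1 -> multilin f ->
  (forall n, gsymn hpair n (reval f)) -> shsym gr k f.
Proof.
move=> sE Mf S xs ys i j u v hu hv; apply/eqP; rewrite -subr_eq0; apply/eqP.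
set c := sg _.
have E a (p q r t : W) : a *: p + q - c *: (a *: r + t) = a *: (p - c *: r) + (q - c *: t).
  by rewrite scalerBr scalerDr !scalerA [c * a]mulrC opprD addrACA.
move: xs; apply: multilin_eq0 => [xs zs a w w'|lx hx].
  by rewrite -!catA !cat_cons !Mf E.
move: ys; apply: multilin_eq0 => [ys zs a w w'|ly hy].
  have E' p q t : map snd lx ++ p :: q :: ys ++ t = (map snd lx ++ p :: q :: ys) ++ t.
    by rewrite -catA.
  by rewrite !E' !Mf E.
apply/eqP; rewrite subr_eq0; apply/eqP.
have := S _ (rev ly) (i + s, u) (j + s, v) (rev lx).
rewrite /reval !map_cat /= !rev_cat !rev_cons -!cats1 -!catA /= !map_rev !revK.
move=> /(_ _ _ (leqnn _)) -> //=.
- by rewrite /c sE; congr (sg _ *: _); ring.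
by rewrite all_cat /= !all_rev hx hy /hpair /= !addrK hu hv.
Qed.

(** The inner bracket is carried from the first input to the last, where the recursion for [f]
    unfolds. The remaining sign is that of an operation of degree 1 passing [l1]. *)
Lemma linf_sumE (W : lmodType K) (f : seq V -> W) (l : seq V -> V) n (x : 'I_n -> V) d :
  (forall n, gsymn hpair n (reval f)) ->
  (forall l', all hpair l' -> ~~ nilp l' -> hpair (dg l' + 1, reval l l')) ->
  homog gr x d ->
  \sum_(c : {ffun 'I_n -> 'I_2} | [exists a, c a == ord0])
     kcol K s d c *: f (l (blk x c ord0) :: blk x c ord_max)
  = spl (rev (lst (shp s x d))) (fun l1 l2 => if nilp l2 then 0 else
      sg (dg l1) *: reval f ((dg l2 + 1, reval l l2) :: l1)).
Proof.
move=> S dl hx; have hL : all hpair (rev (lst (shp s x d))) by rewrite all_rev homog_lst.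
transitivity (spl (rev (lst (shp s x d))) (fun l1 l2 => if nilp l1 then 0 else
    reval f (l2 ++ [:: (dg l1 + 1, reval l l1)]))).
  rewrite -sum_kcol2E big_mkcond; apply: eq_bigr => c _.
  rewrite {1}/nilp size_rev -/(nilp _) nilp_blk; case: existsP => _ /=; last by rewrite scaler0.
  rewrite /reval map_cat /= rev_cat !map_rev !revK !map_snd_blk.
  by [].
rewrite spl_comm; apply: (eq_spl_in hL) => l1 l2 h1 h2 _ _.
case: (boolP (nilp l2)) => n2; first by rewrite scaler0.
rewrite (gsym_move S) ?cats0; last by rewrite all_cat h1 /= dl.
rewrite scalerA -ksignD; congr (_ *: _).
by apply: ksign_mod2 (dg l1 * dg l2) _ _ _; rewrite /=; ring.
Qed.
End Graded.

(** * The transfer recursion *)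

Section Transfer.
Variables (K : fieldType) (s : int) (A B : lmodType K).
Variables (grA : int -> pred A) (grB : int -> pred B).
Hypothesis charK : [pchar K] =i pred0.
Notation sg := (ksign K).
Notation hA := (hpair grA s).
Notation hB := (hpair grB s).
Variables (lamA : seq A -> A) (T : seq B -> A).
Hypothesis lam_lin : multilin lamA.
Hypothesis lam_deg :
  forall l, all hA l -> ~~ nilp l -> hA (dg l + 1, reval lamA l).
Hypothesis lam_gsym : gsym hA (reval lamA).
Notation lr := (reval lamA).
Notation t := (reval T).
Notation tp := (tp t).
Notation pt := (pt t).

(* [twist l] is the bracket twisted by [t], minus its linear part: the sum of
   [lambda(t(b_1), ..., t(b_p), -)] over the partitions of [l] into [p >= 1]
   blocks.  Both recursions of the homotopy transfer then read
   [F (l, y) = g (trees l y)] for [l] nonempty. *)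
Definition lam_ge2 (bs : seq (int * A)) : A := if (size bs <= 1)%N then 0 else lr bs.
Definition twist (l : seq (int * B)) (a : A) : A := pt l (fun bs => lam_ge2 ((0, a) :: bs)).
Definition trees (l : seq (int * B)) (y : B) : A :=
  spl l (fun l1 l2 => twist l1 (t ((0, y) :: l2))).

Lemma lr_lin us e ws : lin (fun a => lr (us ++ (e, a) :: ws)).
Proof. by move=> a u v; rewrite /reval !map_cat /= !rev_cat !rev_cons -!cats1 -!catA lam_lin. Qed.

Lemma lam_ge2_lin us e ws : lin (fun a => lam_ge2 (us ++ (e, a) :: ws)).
Proof.
move=> a u v; rewrite /lam_ge2 !size_cat /=; case: ifP => _; first by rewrite scaler0 addr0.
exact: lr_lin.
Qed.

Lemma lam_ge2_gsym : gsym hA lam_ge2.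
Proof.
move=> us v u ws hv hu; rewrite /lam_ge2 !size_cat /= !addnS /=.
exact: lam_gsym.
Qed.

(** The special block of the transfer formula is just the one that [pt] chooses first, so [y] is not
    distinguished after all. The degree 0 attached to [y] in [trees] is a placeholder: [reval]
    forgets degrees. *)
Lemma trees_pt y l : trees l y.2 = pt (y :: l) lam_ge2.
Proof. by rewrite pt_cons. Qed.

Lemma twist_lin l : lin (twist l).
Proof.
move=> a u v; rewrite /twist -ptZ -ptD; apply: eq_pt => bs.
exact: (lam_ge2_lin [::] 0 bs).
Qed.

(** Ordered blocks and factorials are kept here, with [q] standing for p-1: the passage to
    partitions in [transferE] requires the degrees of [t], which [rec_deg] reads off from this
    form. *)
Lemma transfer_cb (W : lmodType K) (g : A -> W) n (x : 'I_n -> B) d y :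
  transfer_rhs s lamA T g x d y =
  \sum_(q < n.+1 | (0 < q)%N) (q`!%:R)^-1 *:
     spl (rev (lst (shp s x d))) (fun l1 l2 =>
       cb t q l1 (fun bs => g (lr ((0, t ((0, y) :: l2)) :: bs)))).
Proof.
rewrite /transfer_rhs [LHS]big_mkcond [LHS]big_ord_recl [RHS]big_mkcond; apply: (etrans (add0r _)).
apply: eq_bigr => q _; rewrite lift0 ltnS /=; case: ifP => // _; congr (_ *: _).
(* Only the blocks after the head of [bs] must be nonempty; the head is the last block, which also
   holds [y]. *)
pose Phi bs := if all (fun b => ~~ nilp b) (behead bs) then
  g (lr ((0, t ((0, y) :: head [::] bs)) :: map tp (behead bs))) else 0.
transitivity (csum q.+1 (rev (lst (shp s x d))) Phi); last first.
  by apply: eq_spl => l1 l2; rewrite -csum_cb.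
rewrite -sum_kcolE big_mkcond; apply: eq_bigr => c _.
have rE : rblks s x d c = rev (blk (shp s x d) c ord_max) ::
   rev [seq rev (blk (shp s x d) c (widen_ord (leqnSn q) j)) | j <- enum 'I_q].
  by rewrite /rblks enum_ordSr map_rcons rev_rcons -map_comp.
have -> : [forall j : 'I_q.+1, (val j != q) ==> [exists a, c a == j]]
    = all (fun b => ~~ nilp b) (behead (rblks s x d c)).
  rewrite rE /= all_rev all_map; apply/forallP/allP => [H j _|H j] /=.
    move/implyP: (H (widen_ord (leqnSn q) j)) => /=; rewrite neq_ltn ltn_ord => /(_ isT).
    by rewrite /nilp size_rev -/(nilp _) nilp_blk negbK.
  apply/implyP => jq; have jlt : (j < q)%N by rewrite ltn_neqAle jq -ltnS ltn_ord.
  have := H (Ordinal jlt); rewrite mem_enum /nilp /= size_rev -/(nilp _) nilp_blk negbK => -> //.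
rewrite /Phi; case: ifP => _; last by rewrite scaler0.
congr (_ *: g _); rewrite rE /= /reval /= !map_rev enum_ordSr map_rcons /= eqxx.
rewrite [in RHS]rev_cons revK rev_cons revK map_snd_blk; congr (lamA (rcons _ _)).
rewrite -!map_comp; apply: eq_map => j /=.
by rewrite ltn_eqF ?ltn_ord // map_rev revK map_snd_blk.
Qed.

Lemma fact_neq0 q : (q`!%:R : K) != 0.
Proof. by move/pcharf0P: charK => ->; rewrite -lt0n fact_gt0. Qed.

Lemma lam_sumE n (x : 'I_n -> B) d :
  (forall l, all hB l -> ~~ nilp l -> hA (tp l)) -> (0 < n)%N -> homog grB x d ->
  \sum_(p < n.+1 | (0 < p)%N) (p`!%:R)^-1 *:
    \sum_(c : {ffun 'I_n -> 'I_p} | [forall j, [exists a, c a == j]])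
       kcol K s d c *: lamA [seq T (blk x c j) | j <- enum 'I_p]
  = pt (rev (lst (shp s x d))) lr.
Proof.
move=> tP n0 hx; set L := rev _; have hL : all hB L by rewrite all_rev homog_lst.
have sL : size L = n by rewrite size_rev size_lst.
rewrite /pt sL big_mkcond; apply: eq_bigr => p _; case: posnP => [->|p0].
  by case: (L) sL n0 => //= <-.
apply: (scalerI (fact_neq0 p)); rewrite scalerA mulfV ?fact_neq0 // scale1r.
rewrite -(cb_ptp tP) // -csum_cb -sum_kcolE big_mkcond; apply: eq_bigr => c _.
have -> : [forall j, [exists a, c a == j]] = all (fun b => ~~ nilp b) (rblks s x d c).
  rewrite all_rev all_map; apply/forallP/allP => [H j _|H j] /=.
    by rewrite /nilp size_rev -/(nilp _) nilp_blk negbK.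
  by have := H j; rewrite mem_enum /nilp /= size_rev -/(nilp _) nilp_blk negbK => ->.
case: ifP => _; last by rewrite scaler0.
congr (_ *: _); rewrite /reval /rblks !map_rev revK -!map_comp; congr lamA.
by apply: eq_map => j /=; rewrite map_rev revK map_snd_blk.
Qed.

Lemma transferE (W : lmodType K) (g : A -> W) n (x : 'I_n -> B) d y : lin g ->
  (forall l, all hB l -> ~~ nilp l -> hA (tp l)) -> homog grB x d ->
  transfer_rhs s lamA T g x d y = g (trees (rev (lst (shp s x d))) y).
Proof.
move=> Lg tP hx; rewrite transfer_cb.
have hL : all hB (rev (lst (shp s x d))) by rewrite all_rev homog_lst.
have sL : size (rev (lst (shp s x d))) = n by rewrite size_rev size_lst.
rewrite /trees spl_lin //.
transitivity (\sum_(q < n.+1) spl (rev (lst (shp s x d))) (fun l1 l2 =>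
       ptp t q l1 (fun bs => g (lam_ge2 ((0, t ((0, y) :: l2)) :: bs))))); last first.
  rewrite -spl_sum; apply: eq_spl_dg => l1 l2 sz _.
  by rewrite sum_ptp ?pt_lin // -sL -sz leq_addr.
(* The term [q = 0] would be the unary bracket: the transfer formula omits it and [lam_ge2] kills
   it. *)
rewrite big_mkcond; apply: eq_bigr => q _; case: ifP => q0; last first.
  case: (nat_of_ord q) q0 => // _; rewrite -[LHS](spl0 W (rev (lst (shp s x d)))).
  by apply: eq_spl => -[|? ?] l2 //=; rewrite /lam_ge2 (lin0 Lg).
apply: (scalerI (fact_neq0 q)); rewrite scalerA mulfV ?fact_neq0 // scale1r -splZ.
apply: (eq_spl_in hL) => l1 l2 h1 h2 _ _.
rewrite (cb_ptp tP) //; last first.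
  move=> us v u ws hv hu; rewrite -(linZ Lg); congr g.
  exact: (lam_gsym (_ :: us)).
by congr (_ *: _); case: (nat_of_ord q) q0 => // q' _; apply: eq_ptpS.
Qed.

(** * Degree and symmetry of the transferred maps *)

Section Recursion.
Variables (W : lmodType K) (grW : int -> pred W) (F : seq B -> W) (g : A -> W) (base : B -> W).
Variable e : int.
Hypotheses (Wgr : graded_space grW) (g_lin : lin g) (g_deg : of_degree grA grW e g).
Hypotheses (base_deg : of_degree grB grW (e + 1) base) (F1 : forall y, F [:: y] = base y).
Hypothesis F_rec : forall n (x : 'I_n -> B) (d : 'I_n -> int) y, (0 < n)%N -> homog grB x d ->
  F (rcons (lst x) y) = transfer_rhs s lamA T g x d y.

(** Serves both recursions: [g] is [h] with base [tau] and [e = -1], or [sigma] with base [dB] and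
    [e = 0]; the extra 1 is the shifted degree of a bracket. Since a bracket has at least two
    arguments, [t] occurs only on strictly shorter lists. *)
Lemma rec_deg l : all hB l -> ~~ nilp l ->
  (forall l', all hB l' -> ~~ nilp l' -> (size l' < size l)%N -> hA (tp l')) ->
  hpair grW s (dg l + e + 1, reval F l).
Proof.
case: l => // y l /= /andP[hy hl] _ tP; case: l hl tP => [|z l] hl tP.
  rewrite /hpair /= dg_cons dg_nil addr0 /reval /= F1.
  by have := base_deg hy; congr grW; ring.
have [n [x [d [nE hx LE]]]] := lst_homog (etrans (all_rev _ _) hl).
have lE : z :: l = rev (lst (shp s x d)) by rewrite -LE revK.
rewrite -[hpair _ _ _]/(grW (dg (y :: z :: l) + e + 1 - s) (reval F (y :: z :: l))).
have -> : reval F (y :: z :: l) = transfer_rhs s lamA T g x d y.2.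
  by rewrite lE -F_rec ?nE ?size_rev // /reval /= rev_cons map_rev revK map_snd_lst.
rewrite transfer_cb -lE dg_cons; apply: (big_ind (fun w : W => is_true (grW _ w))) => [|a b|q q0]; first exact: gr_zero.
  exact: gr_add.
apply: (gr_scale Wgr); case: q q0 => [[|q] ltq] // _.
apply: (spl_closed (h := hB) (P := fun w : W => is_true (grW (y.1 + dg (z :: l) + e + 1 - s) w))) => // [a b|c a|l1 l2 h1 h2 sz ds]; first exact: gr_add.
  exact: gr_scale.
case: l1 h1 sz ds => [|x1 l1] h1 sz ds; first exact: (gr_zero Wgr).
apply: (cb_closed (h := hB) (P := fun w : W => is_true (grW (y.1 + dg (z :: l) + e + 1 - s) w)) (h' := hA)) => // [|a b|c a|l' hl' nl' sl'|bs hbs dbs].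
- exact: gr_zero.
- exact: gr_add.
- exact: gr_scale.
- by apply: tP => //; move: sz sl' => /=; lia.
have hb : hA (tp (y :: l2)) by apply: tP => //=; rewrite ?hy //; move: sz => /=; lia.
have := @lam_deg (tp (y :: l2) :: bs); rewrite /= hb hbs => /(_ isT isT) /g_deg.
rewrite /= !dg_cons /= dbs !dg_cons; congr grW; move: ds; rewrite !dg_cons; lia.
Qed.

Hypothesis tP : forall l, all hB l -> ~~ nilp l -> hA (tp l).

Lemma recE y l : all hB l ->
  reval F (y :: l) = (if nilp l then base y.2 else 0) + g (trees l y.2).
Proof.
case: l => [|z l] hl; first by rewrite /trees /= /twist pt_nil /lam_ge2 lin0 // addr0 /reval F1.
have [n [x [d [nE hx LE]]]] := lst_homog (etrans (all_rev _ _) hl).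
have lE : z :: l = rev (lst (shp s x d)) by rewrite -LE revK.
rewrite add0r lE -transferE // -F_rec ?nE ?size_rev //.
by rewrite /reval /= rev_cons map_rev revK map_snd_lst.
Qed.

(** The gain of one input comes from [lam_ge2], which removes the one-block partition, the only term
    where [t] would see the whole list. *)
Lemma rec_gsym n : gsymn hB n t -> gsymn hB n.+1 (reval F).
Proof.
move=> St us v u ws hl ln.
have E y l : all hB l -> ~~ nilp l -> reval F (y :: l) = g (pt (y :: l) lam_ge2).
  by move=> hl' /negbTE nl; rewrite recE // nl add0r trees_pt.
have [x1 [l1 [E1 n1]]] : exists y l, us ++ v :: u :: ws = y :: l /\ ~~ nilp l.
  by case: (us) => [|y [|z us']] /=; do 2!eexists.
have [x2 [l2 [E2 n2]]] : exists y l, us ++ u :: v :: ws = y :: l /\ ~~ nilp l.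
  by case: (us) => [|y [|z us']] /=; do 2!eexists.
have hl2 : all hB (us ++ u :: v :: ws).
  by move: hl; rewrite !all_cat /= => /and4P[-> -> -> ->].
have tail x l : all hB (x :: l) -> all hB l by case/andP.
have [al1 al2] : all hB l1 /\ all hB l2.
  by move: hl hl2; rewrite E1 E2 => /tail ? /tail.
rewrite E1 E2 !E // -E1 -E2 -(linZ g_lin); congr g.
apply: (pt_gsym (h := hB) tP St lam_ge2_gsym) => //; last by right.
by move=> us' e' a b ws'; apply: (linZ (lam_ge2_lin us' e' ws')).
Qed.

End Recursion.
End Transfer.

(** * The L-infinity relations *)

Section Morphism.
Variables (K : fieldType) (s : int) (A B : lmodType K).
Variables (grA : int -> pred A) (grB : int -> pred B).
Notation sg := (ksign K).
Notation hA := (hpair grA s).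
Notation hB := (hpair grB s).
Variables (dA : A -> A) (dB : B -> B) (sigma : A -> B) (tau : B -> A) (h : A -> A).
Variables (lamA : seq A -> A) (ellB : seq B -> B) (T : seq B -> A).
Hypotheses (sigma_lin : lin sigma) (tau_lin : lin tau) (h_lin : lin h).
Hypotheses (dA_lin : lin dA).
Hypothesis sigma_d : forall a, sigma (dA a) = dB (sigma a).
Hypothesis tau_d : forall x, tau (dB x) = dA (tau x).
Hypothesis sigma_tau : forall x, sigma (tau x) = x.
Hypothesis homotopy : forall a, h (dA a) + dA (h a) = tau (sigma a) - a.
Hypothesis sigma_h : forall a, sigma (h a) = 0.
Hypothesis dAA : forall a, dA (dA a) = 0.
Hypothesis lam_lin : multilin lamA.
Hypothesis lam1 : forall a, lamA [:: a] = dA a.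
Notation lr := (reval lamA).
Notation lam_ge2 := (lam_ge2 lamA).
Notation t := (reval T).
Notation e := (reval ellB).
Notation tp := (tp t).
Notation pt := (pt t).
Notation twist := (twist lamA T).
Notation trees := (trees lamA T).
Hypothesis lam_linf : forall bs, all hA bs -> spl bs (fun a1 a2 =>
  if nilp a2 then 0 else sg (dg a1) *: lr ((dg a2 + 1, lr a2) :: a1)) = 0.
Hypothesis tP : forall l, all hB l -> ~~ nilp l -> hA (tp l).
Hypothesis tE : forall y l, all hB l ->
  t (y :: l) = (if nilp l then tau y.2 else 0) + h (trees l y.2).
Hypothesis eE : forall y l, all hB l ->
  e (y :: l) = (if nilp l then dB y.2 else 0) + sigma (trees l y.2).

Let Lam (l : seq (int * B)) (a : A) : A := pt l (fun bs => lr ((0, a) :: bs)).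

Let LamE l a : Lam l a = twist l a + (if nilp l then dA a else 0).
Proof.
case: l => [|y l] /=; first by rewrite /Lam /twist !pt_nil /reval /= lam1 add0r.
rewrite addr0; apply: eq_pt_nilp => -[|b bs] _ //.
Qed.

Let twist0 l : twist l 0 = 0. Proof. exact: (lin0 (twist_lin _ lam_lin _)). Qed.

Let PtE y l : pt (y :: l) lr = dA (t (y :: l)) + trees l y.2.
Proof.
rewrite pt_cons addrC -(spl_nill l (fun l2 => dA (t (y :: l2)))) -splD.
by apply: eq_spl => l1 l2; rewrite -LamE.
Qed.

(** A Bianchi identity for the curvature [pt l lr]: the relations of A are evaluated on the blocks
    of each partition, and [pt_spl] regroups the sum into a curvature on [l2] inside a twisted
    differential on [l1]. *)
Let pt_linf l : all hB l -> ~~ nilp l ->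
  dA (pt l lr) + spl l (fun l1 l2 =>
    if nilp l2 then 0 else sg (dg l1) *: twist l1 (pt l2 lr)) = 0.
Proof.
move=> hl nl.
have E : pt l (fun bs => spl bs (fun a1 a2 => if nilp a2 then 0 else
    sg (dg a1) *: lr ((dg a2 + 1, lr a2) :: a1))) = 0.
  rewrite -[RHS](pt0 t A l); apply: (eq_pt_in tP hl) => bs hbs _ _; exact: lam_linf.
rewrite -[RHS]E pt_spl -(spl_nill l (fun l2 => dA (pt l2 lr))) -splD.
apply: eq_spl_dg => l1 l2 sz _.
transitivity (if nilp l2 then 0 else sg (dg l1) *: Lam l1 (pt l2 lr)).
  case: (boolP (nilp l2)) => n2; last first.
    rewrite LamE scalerDr addrC; congr (_ + _).
    by case: l1 sz => [|x l1] _ /=; rewrite ?scaler0 // dg_nil scale1r.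
  have -> : nilp l1 = false; last by rewrite addr0.
  by move: sz nl; rewrite /nilp (eqP n2) addn0 => -> /negbTE.
symmetry; rewrite /Lam; case: ifP => n2.
  rewrite -[RHS](pt0 t A l1); apply: eq_pt => a1; rewrite -[RHS](pt0 t A l2).
  by apply: eq_pt_nilp => a2 _ ->; rewrite n2.
rewrite -ptZ; apply: eq_pt_nilp => a1 -> _.
have -> : lr ((0, pt l2 lr) :: a1) = pt l2 (fun a2 => lr ((0, lr a2) :: a1)).
  exact: (pt_lin (f := fun a => lr ((0, a) :: a1)) _ _ _ (lr_lin lam_lin [::] 0 a1)).
rewrite -ptZ.
by apply: eq_pt_nilp => a2 _ ->; rewrite n2.
Qed.

(** Only the homotopy identity and [dAA] enter: the curvature is [dA] of [t] plus [trees], and [dA]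
    sees only the second summand. The relations of A come in later, through [pt_linf], to rewrite
    [dA] of the curvature. *)
Lemma pt_lam l : all hB l -> ~~ nilp l -> pt l lr = tau (e l) - h (dA (pt l lr)).
Proof.
case: l => // y l /= /andP[hy hl] _.
have E : dA (pt (y :: l) lr) = dA (trees l y.2).
  by rewrite PtE (linD dA_lin) dAA add0r.
rewrite E PtE tE // eE // (linD dA_lin) (linD tau_lin).
have -> : dA (h (trees l y.2)) = tau (sigma (trees l y.2)) - trees l y.2 - h (dA (trees l y.2)).
  by rewrite -homotopy addrC addKr.
have -> : dA (if nilp l then tau y.2 else 0) = tau (if nilp l then dB y.2 else 0).
  by case: ifP => _; rewrite ?tau_d // (lin0 dA_lin) (lin0 tau_lin).
by rewrite -!addrA; do 2!congr (_ + _); rewrite addrCA addNr addr0.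
Qed.

(* The composite of [t] with [e]; its sign comes from moving [e] past [l1]. *)
Definition tell (l : seq (int * B)) : A := spl l (fun l1 l2 =>
  if nilp l2 then 0 else sg (dg l1) *: t ((dg l2 + 1, e l2) :: l1)).

(** Unfolding [F] at its last input, a value of [e], leaves that value inside a shorter [t];
    coassociativity then reassembles [tell]. It is applied to [t] for the morphism relation and to
    [e] for the relations on B. *)
Lemma compose_ell (W : lmodType K) (F : seq B -> W) (g : A -> W) (base : B -> W) l :
  lin g -> all hB l ->
  (forall y l, all hB l -> reval F (y :: l) = (if nilp l then base y.2 else 0) + g (trees l y.2)) ->
  spl l (fun l1 l2 => if nilp l2 then 0 else
     sg (dg l1) *: reval F ((dg l2 + 1, e l2) :: l1))
  = (if nilp l then 0 else base (e l))
    + g (spl l (fun l1 l2 => sg (dg l1) *: twist l1 (tell l2))).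
Proof.
move=> g_lin hl FE.
rewrite -(spl_nill l (fun l2 => if nilp l2 then 0 else base (e l2))).
pose G m1 m2 m3 : A := if nilp m3 then 0 else
  sg (dg m1 + dg m2) *: twist m1 (t ((0, e m3) :: m2)).
transitivity (spl l (fun l1 l2 => if nilp l1 then if nilp l2 then 0 else base (e l2) else 0)
   + g (spl l (fun l1 l2 => spl l1 (fun m1 m2 => G m1 m2 l2)))).
  rewrite (spl_lin _ _ g_lin) -splD; apply: (eq_spl_in hl) => l1 l2 h1 h2 _ _.
  rewrite /G; case: (nilp l2); first by rewrite spl0 if_same lin0 // addr0.
  rewrite FE // scalerDr /=; congr (_ + _).
    by case: l1 h1 => [|x l1] _ /=; rewrite ?scaler0 // dg_nil scale1r.
  rewrite -(linZ g_lin) -splZ; congr g; apply: eq_spl_dg => m1 m2 _ dm.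
  by rewrite dm.
rewrite (spl_assoc l G); congr (_ + g _); apply: eq_spl => m1 l'.
rewrite /tell (spl_lin _ _ (twist_lin _ lam_lin _)) -splZ; apply: eq_spl => m2 m3.
rewrite /G; case: (nilp m3); first by rewrite twist0 scaler0.
by rewrite (linZ (twist_lin _ lam_lin _)) scalerA -ksignD.
Qed.

(* The difference R of both sides satisfies R = h (twist * R), where [twist]
   consumes at least one input, so R vanishes by induction. *)
Lemma morphism_eq l : all hB l -> ~~ nilp l -> tell l = pt l lr.
Proof.
have [n] := ubnP (size l); elim: n l => // n IH l ln hl nl.
rewrite /tell (compose_ell h_lin hl tE) (negbTE nl) pt_lam //; congr (_ + _).
have := pt_linf hl nl; move/(canRL (addrK _)); rewrite add0r => ->.
rewrite (linN h_lin) opprK; congr h; apply: (eq_spl_in hl) => l1 l2 h1 h2 sz _.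
case: (boolP (nilp l2)) => n2; last first.
  case: l1 h1 sz => [|x l1] h1 sz; last by rewrite IH //; move: sz => /=; lia.
  by rewrite /twist !pt_nil.
by move/nilP: n2 => ->; rewrite /tell /= twist0 scaler0.
Qed.

Lemma linf_eq l : all hB l ->
  spl l (fun l1 l2 => if nilp l2 then 0 else
     sg (dg l1) *: e ((dg l2 + 1, e l2) :: l1)) = 0.
Proof.
move=> hl; have [/nilP -> //|nl] := boolP (nilp l).
rewrite (compose_ell sigma_lin hl eE) (negbTE nl).
have E : spl l (fun l1 l2 => sg (dg l1) *: twist l1 (tell l2)) = - dA (pt l lr).
  have := pt_linf hl nl; move/(canRL (addKr _)); rewrite addr0 => <-.
  apply: (eq_spl_in hl) => l1 l2 h1 h2 _ _.
  case: (boolP (nilp l2)) => [/nilP ->|n2]; last by rewrite morphism_eq.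
  by rewrite /tell /= twist0 scaler0.
(* [sigma] maps the curvature to [e l], so this term is minus [dB (e l)] and cancels the unary
   one. *)
rewrite E (linN sigma_lin) sigma_d [in X in _ - X]pt_lam // (linD sigma_lin) sigma_tau.
by rewrite (linN sigma_lin) sigma_h subr0 subrr.
Qed.
End Morphism.

(** * Compatibility with the products *)

Section Multiplicative.
Variables (K : fieldType) (s : int) (A B : lmodType K).
Variables (grA : int -> pred A) (grB : int -> pred B).
Hypothesis Agr : graded_space grA.
Notation sg := (ksign K).
Notation hA := (hpair grA s).
Notation hB := (hpair grB s).
Variables (mulA : A -> A -> A) (mulB : B -> B -> B).
Variables (dB : B -> B) (sigma : A -> B) (tau : B -> A) (h : A -> A).
Variables (lamA : seq A -> A) (ellB : seq B -> B) (T : seq B -> A).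
Hypotheses (gcaA : gca grA mulA) (gcaB : gca grB mulB).
Hypotheses (sigma_lin : lin sigma) (h_lin : lin h).
Hypotheses (sigma_deg : of_degree grA grB 0 sigma) (tau_deg : of_degree grB grA 0 tau).
Hypothesis (h_deg : of_degree grA grA (-1) h).
Hypothesis semi : semifull grA mulA mulB sigma tau h.
Hypothesis dB_mul : forall i u v, grB i u ->
  dB (mulB u v) = mulB (dB u) v + sg i *: mulB u (dB v).
Hypothesis lam_lin : multilin lamA.
Hypothesis lam_deg :
  forall l, all hA l -> ~~ nilp l -> hA (dg l + 1, reval lamA l).
Notation lr := (reval lamA).
Notation lam_ge2 := (lam_ge2 lamA).
Notation t := (reval T).
Notation e := (reval ellB).
Notation tp := (tp t).
Notation pt := (pt t).
Notation twist := (twist lamA T).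
Notation trees := (trees lamA T).
Hypothesis lam_der : forall bs i a b, all hA bs -> grA i a ->
  lr ((0, mulA a b) :: bs) = mulA (lr ((0, a) :: bs)) b
    + sg (i * (1 + dg bs)) *: mulA a (lr ((0, b) :: bs)).
Hypothesis tP : forall l, all hB l -> ~~ nilp l -> hA (tp l).
Hypothesis tE : forall y l, all hB l ->
  t (y :: l) = (if nilp l then tau y.2 else 0) + h (trees l y.2).
Hypothesis eE : forall y l, all hB l ->
  e (y :: l) = (if nilp l then dB y.2 else 0) + sigma (trees l y.2).

Let phi l y := t ((0, y) :: l).

Let mulAl b : lin (mulA^~ b). Proof. by case: gcaA. Qed.
Let mulAr a : lin (mulA a). Proof. by case: gcaA. Qed.
Let mulBl b : lin (mulB^~ b). Proof. by case: gcaB. Qed.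
Let mulBr a : lin (mulB a). Proof. by case: gcaB. Qed.

Let mulA0l b : mulA 0 b = 0. Proof. exact: (lin0 (mulAl b)). Qed.
Let mulA0r b : mulA b 0 = 0. Proof. exact: (lin0 (mulAr b)). Qed.
Let mulADl a a' b : mulA (a + a') b = mulA a b + mulA a' b. Proof. exact: (linD (mulAl b)). Qed.
Let mulADr a b b' : mulA a (b + b') = mulA a b + mulA a b'. Proof. exact: (linD (mulAr a)). Qed.

Let twist_nil a : twist [::] a = 0. Proof. by rewrite /twist pt_nil. Qed.

Let lam_ge2_der bs i a b : all hA bs -> grA i a ->
  lam_ge2 ((0, mulA a b) :: bs) = mulA (lam_ge2 ((0, a) :: bs)) b
    + sg (i * (1 + dg bs)) *: mulA a (lam_ge2 ((0, b) :: bs)).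
Proof.
move=> hbs ha; rewrite /lam_ge2 /=; case: ifP => _; last exact: lam_der.
by rewrite mulA0l mulA0r scaler0 addr0.
Qed.

Lemma twist_der l i a b : all hB l -> grA i a ->
  twist l (mulA a b) = mulA (twist l a) b + sg (i * (1 + dg l)) *: mulA a (twist l b).
Proof.
move=> hl ha.
rewrite /twist (pt_lin _ _ _ (mulAl b)) (pt_lin _ _ _ (mulAr a)) -ptZ -ptD.
by apply: (eq_pt_in tP hl) => bs hbs <- _; apply: lam_ge2_der.
Qed.

Let phi_deg l i y : all hB l -> grB i y -> grA (i + dg l) (phi l y).
Proof.
move=> hl hy; have := tP (l := (i + s, y) :: l).
rewrite /hpair /= addrK hy hl => /(_ isT isT); rewrite dg_cons; congr grA.
by rewrite /=; ring.
Qed.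

Lemma trees_deg l i y : all hB l -> grB i y -> grA (i + dg l + 1) (trees l y).
Proof.
move=> hl hy; apply: (spl_closed (h := hB) (P := fun w : A => is_true (grA (i + dg l + 1) w))) => //.
- by move=> *; apply: gr_add.
- by move=> *; apply: gr_scale.
move=> l1 l2 h1 h2 sz ds.
apply: (pt_closed (h := hB) (h' := hA) (P := fun w : A => is_true (grA (i + dg l + 1) w)) _ _ tP) => //.
- by move=> *; apply: gr_add.
- by move=> *; apply: gr_scale.
move=> bs hbs dbs _; rewrite /lam_ge2; case: ifP => _; first exact: gr_zero.
have := lam_deg (l := (i + dg l2 + s, phi l2 y) :: bs).
rewrite /= hbs {1}/hpair /= addrK (phi_deg h2 hy) => /(_ isT isT).
by rewrite /hpair /= dg_cons /= dbs -ds; congr grA; ring.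
Qed.

(** [twist] vanishes on the empty list, so the product formula is needed only on lists shorter than
    [l]; the Leibniz rule then applies to each product. *)
Lemma trees_mul l i y z : all hB l -> grB i y ->
  (forall l', all hB l' -> (size l' < size l)%N -> phi l' (mulB y z)
     = spl l' (fun m1 m2 => sg (i * dg m2) *: mulA (phi m1 y) (phi m2 z))) ->
  trees l (mulB y z) = spl l (fun l1 l2 => sg (i * dg l2) *:
    (mulA (trees l1 y) (phi l2 z) + sg (i + dg l1) *: mulA (phi l1 y) (trees l2 z))).
Proof.
move=> hl hy IH.
(* [C] and [D] are the two Leibniz terms. In [D] the bracket jumps over [phi b y], so the blocks [a]
   and [b] must be exchanged before [trees] reappears on the right factor. *)
pose C a b c : A := sg (i * dg c) *: mulA (twist a (phi b y)) (phi c z).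
pose D a b c : A := sg (i * dg c + (i + dg b) * (1 + dg a)) *: mulA (phi b y) (twist a (phi c z)).
transitivity (spl l (fun l1 l2 => spl l2 (fun m1 m2 => C l1 m1 m2 + D l1 m1 m2))).
  apply: (eq_spl_in hl) => l1 l2 h1 h2 sz _.
  case: l1 h1 sz => [|x l1] h1 sz.
    rewrite twist_nil -[LHS](spl0 A l2); apply: eq_spl => m1 m2.
    by rewrite /C /D !twist_nil mulA0l mulA0r !scaler0 addr0.
  rewrite -/(phi _ _) IH //; last by move: sz => /=; lia.
  rewrite (spl_lin _ _ (twist_lin _ lam_lin _)); apply: (eq_spl_in h2) => m1 m2 hm1 hm2 _ _.
  rewrite (linZ (twist_lin _ lam_lin _)) (twist_der _ _ (phi_deg hm1 hy)) //.
  by rewrite scalerDr scalerA -ksignD.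
transitivity (spl l (fun l1 l2 => sg (i * dg l2) *: mulA (trees l1 y) (phi l2 z))
  + spl l (fun l1 l2 => sg (i * dg l2 + (i + dg l1)) *: mulA (phi l1 y) (trees l2 z))); last first.
  by rewrite -splD; apply: eq_spl => l1 l2; rewrite scalerDr scalerA -ksignD.
transitivity (spl l (fun l1 l2 => spl l2 (C l1)) + spl l (fun l1 l2 => spl l2 (D l1))).
  by rewrite -splD; apply: eq_spl => l1 l2; rewrite -splD.
congr (_ + _); rewrite -spl_assoc.
  apply: eq_spl => l1 l2; rewrite /trees (spl_lin _ _ (mulAl _)) -splZ.
  by apply: eq_spl.
transitivity (spl l (fun l1 l2 => spl l1 (fun a b => sg (dg a * dg b) *: D b a l2))).
  by apply: eq_spl => l1 l2; rewrite spl_comm.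
rewrite (spl_assoc l (fun a b c => sg (dg a * dg b) *: D b a c)).
apply: eq_spl => l1 l2; rewrite /trees (spl_lin _ _ (mulAr _)) -splZ.
apply: eq_spl_dg => a b _ <-; rewrite scalerA -ksignD; congr (_ *: _).
by apply: ksign_mod2 (dg l1 * dg a) _ _ _; ring.
Qed.

Let tau_comm i y v j : grB i y -> grA j v ->
  mulA (tau y) v = sg (i * j) *: mulA v (tau y).
Proof.
move=> hy hv; case: gcaA => _ _ _ _; apply => //.
by have := tau_deg hy; rewrite addr0.
Qed.

(** The semifull identity concerns multiplication by [tau y] on the right; graded commutativity
    transports it to the left for homogeneous [v], and the degree -1 of [h] leaves the sign. *)
Lemma h_tau_mul i y v : grB i y -> h (mulA (tau y) v) = sg i *: mulA (tau y) (h v).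
Proof.
move=> hy; case: semi => _ h_tau _ _ _; move: v.
apply: (lin_eq_homog Agr) => [a u v|a u v|j v hv]; first by rewrite mulAr h_lin.
  by rewrite h_lin mulAr scalerDr !scalerA mulrC.
rewrite (tau_comm hy hv) (tau_comm hy (h_deg hv)) (linZ h_lin) h_tau scalerA -ksignD.
by congr (_ *: _); apply: ksign_mod2 0 _ _ _; ring.
Qed.

Lemma sigma_tau_mul i y v : grB i y -> sigma (mulA (tau y) v) = mulB y (sigma v).
Proof.
move=> hy; case: semi => _ _ _ s_tau _; move: v.
apply: (lin_eq_homog Agr) => [a u v|a u v|j v hv]; first by rewrite mulAr sigma_lin.
  by rewrite sigma_lin mulBr.
rewrite (tau_comm hy hv) (linZ sigma_lin) s_tau.
have -> : mulB (sigma v) y = sg ((j + 0) * i) *: mulB y (sigma v).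
  by case: gcaB => _ _ _ _; apply => //; apply: sigma_deg.
rewrite scalerA -ksignD addr0 (@ksign_mod2 _ (i * j) _ 0) ?ksign0 ?scale1r //.
by ring.
Qed.

Let phiE l y : all hB l -> phi l y = (if nilp l then tau y else 0) + h (trees l y).
Proof. exact: tE. Qed.

(* Here the identity h(+-h(a)b + a h(b)) = h(a)h(b) is used, with a and b the
   arguments of h in [phi l1 y] and [phi l2 z]. *)
Lemma h_term l1 l2 i y z : all hB l1 -> all hB l2 -> grB i y ->
  mulA (phi l1 y) (phi l2 z) =
    (if nilp l1 then if nilp l2 then mulA (tau y) (tau z) else 0 else 0)
    + h (mulA (trees l1 y) (phi l2 z) + sg (i + dg l1) *: mulA (phi l1 y) (trees l2 z)).
Proof.
move=> h1 h2 hy; case: semi => hh h_tau _ _ _.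
rewrite !phiE // !mulADl !mulADr scalerDr.
(* [trees l1 y] has degree [i + dg l1 + 1], so the exponent in the semifull identity exceeds
   [i + dg l1] by 2. *)
have E : h (mulA (trees l1 y) (h (trees l2 z)) + sg (i + dg l1) *: mulA (h (trees l1 y)) (trees l2 z))
     = mulA (h (trees l1 y)) (h (trees l2 z)).
  rewrite -(hh _ _ _ (trees_deg h1 hy)) addrC; congr (h (_ *: _ + _)).
  by apply: ksign_mod2 (-1) _ _ _; ring.
rewrite [X in _ = _ + h X]addrACA [in RHS](linD h_lin) E (linD h_lin).
have -> : h (mulA (trees l1 y) (if nilp l2 then tau z else 0))
    = mulA (h (trees l1 y)) (if nilp l2 then tau z else 0).
  by case: ifP; rewrite ?h_tau // !mulA0r (lin0 h_lin).
have -> : h (sg (i + dg l1) *: mulA (if nilp l1 then tau y else 0) (trees l2 z))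
    = mulA (if nilp l1 then tau y else 0) (h (trees l2 z)).
  case: nilP => [->|_]; last by rewrite !mulA0l scaler0 (lin0 h_lin).
  rewrite (linZ h_lin) (h_tau_mul _ hy) dg_nil addr0 scalerA -ksignD.
  by rewrite (@ksign_mod2 _ i _ 0) ?ksign0 ?scale1r // add0r.
rewrite -!addrA [X in _ = _ + X]addrCA; congr (_ + _).
by case: ifP => _; case: ifP => _; rewrite ?mulA0l ?mulA0r.
Qed.

(** By induction on the length: [trees_mul] consumes the formula on shorter lists and [h_term]
    returns it on [l], the base term being the multiplicativity of [tau]. *)
Lemma phi_mul l i y z : all hB l -> grB i y ->
  phi l (mulB y z) = spl l (fun m1 m2 => sg (i * dg m2) *: mulA (phi m1 y) (phi m2 z)).
Proof.
move=> hl hy; have [n] := ubnP (size l); elim: n l hl => // n IH l hl ln.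
rewrite phiE // (trees_mul hl hy); last by move=> l' hl' sl; apply: IH => //; lia.
rewrite (spl_lin _ _ h_lin).
rewrite -(spl_nill l (fun l2 => if nilp l2 then tau (mulB y z) else 0)) -splD.
apply: (eq_spl_in hl) => l1 l2 h1 h2 _ _.
rewrite (h_term z h1 h2 hy) (linZ h_lin) [in RHS]scalerDr; congr (_ + _).
case: ifP => _; last by rewrite scaler0.
case: nilP => [->|_]; last by rewrite scaler0.
by rewrite dg_nil mulr0 scale1r; case: semi.
Qed.

(** Under [sigma] the terms with [h] on a factor drop out together, so one factor must be the bare
    [tau y] or [tau z] and its list empty. Hence the brackets obey a Leibniz rule where [t] obeys a
    full convolution formula. *)
Lemma sigma_term l1 l2 i y z : all hB l1 -> all hB l2 -> grB i y ->
  sigma (mulA (trees l1 y) (phi l2 z) + sg (i + dg l1) *: mulA (phi l1 y) (trees l2 z))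
  = (if nilp l2 then mulB (sigma (trees l1 y)) z else 0)
    + (if nilp l1 then sg i *: mulB y (sigma (trees l2 z)) else 0).
Proof.
move=> h1 h2 hy; case: semi => _ _ ss s_tau _.
rewrite !phiE // mulADl mulADr scalerDr.
have E : sigma (mulA (trees l1 y) (h (trees l2 z)) + sg (i + dg l1) *: mulA (h (trees l1 y)) (trees l2 z)) = 0.
  rewrite -(ss _ _ (trees l2 z) (trees_deg h1 hy)) addrC; congr (sigma (_ *: _ + _)).
  by apply: ksign_mod2 (-1) _ _ _; ring.
rewrite addrACA (linD sigma_lin) E addr0 (linD sigma_lin); congr (_ + _).
  by case: ifP; rewrite ?s_tau // mulA0r (lin0 sigma_lin).
case: nilP => [->|_]; last by rewrite mulA0l scaler0 (lin0 sigma_lin).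
by rewrite (linZ sigma_lin) (sigma_tau_mul _ hy) dg_nil addr0.
Qed.

Lemma ell_mul l i y z : all hB l -> grB i y ->
  e ((0, mulB y z) :: l) = mulB (e ((0, y) :: l)) z
    + sg (i * (1 + dg l)) *: mulB y (e ((0, z) :: l)).
Proof.
move=> hl hy; rewrite !eE // (trees_mul hl hy) /=; last by move=> *; apply: phi_mul.
rewrite (spl_lin _ _ sigma_lin).
have -> : spl l (fun l1 l2 => sigma (sg (i * dg l2) *:
    (mulA (trees l1 y) (phi l2 z) + sg (i + dg l1) *: mulA (phi l1 y) (trees l2 z))))
  = mulB (sigma (trees l y)) z + sg (i * (1 + dg l)) *: mulB y (sigma (trees l z)).
  rewrite -(spl_nilr l (fun l1 => mulB (sigma (trees l1 y)) z)).
  rewrite -(spl_nill l (fun l2 => mulB y (sigma (trees l2 z)))) -splZ -splD.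
  apply: (eq_spl_in hl) => l1 l2 h1 h2 _ <-.
  rewrite (linZ sigma_lin) (sigma_term z h1 h2 hy) scalerDr; congr (_ + _).
    by case: nilP => [->|_]; rewrite ?scaler0 // dg_nil mulr0 scale1r.
  case: nilP => [->|_]; rewrite ?scaler0 // dg_nil add0r scalerA -ksignD.
  by congr (sg _ *: _); ring.
rewrite (linD (mulBl z)) (linD (mulBr y)) scalerDr addrACA; congr (_ + _).
case: nilP => [->|_]; last by rewrite (lin0 (mulBl z)) (lin0 (mulBr y)) scaler0 addr0.
by rewrite (dB_mul _ hy) dg_nil addr0 mulr1.
Qed.
End Multiplicative.

(** * The theorem: passage between indexed families and lists of graded inputs *)

Lemma nilp_rev_lst T n (x : 'I_n -> T) : nilp (rev (lst x)) = (n == 0)%N.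
Proof. by rewrite /nilp size_rev size_lst. Qed.

Theorem mainTheorem5 (K : fieldType) (k : int) (A B : lmodType K)
  (grA : int -> pred A) (grB : int -> pred B)
  (mulA : A -> A -> A) (mulB : B -> B -> B) (dA : A -> A) (dB : B -> B)
  (sigma : A -> B) (tau : B -> A) (h : A -> A)
  (lamA : seq A -> A) (ellB : seq B -> B) (tauInf : seq B -> A) :
  [pchar K] =i pred0 ->
  graded_space grA -> graded_space grB ->
  dgca grA mulA dA -> dgca grB mulB dB ->
  contraction grA grB dA dB sigma tau h ->
  semifull grA mulA mulB sigma tau h ->
  derived_poisson k grA mulA lamA ->
  (forall a, lamA [:: a] = dA a) ->
  (* the transferred structure ell and the L_oo quasi-isomorphism tauInf *)
  (forall y, tauInf [:: y] = tau y) ->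
  (forall y, ellB [:: y] = dB y) ->
  multilin tauInf -> multilin ellB ->
  (forall n (x : 'I_n -> B) d y, (0 < n)%N -> homog grB x d ->
     tauInf (rcons (lst x) y) = transfer_rhs (k - 1) lamA tauInf h x d y) ->
  (forall n (x : 'I_n -> B) d y, (0 < n)%N -> homog grB x d ->
     ellB (rcons (lst x) y) = transfer_rhs (k - 1) lamA tauInf sigma x d y) ->
  derived_poisson k grB mulB ellB /\
  dp_morphism k grB grA mulB mulA ellB lamA tauInf.
Proof.
move=> charK Agr Bgr [gcaA dA_lin _ dAA _] [gcaB dB_lin dB_deg _ dB_mul].
move=> [[s_lin t_lin h_lin s_deg] [t_deg h_deg] [s_d t_d s_t] hom [s_h _ _]].
move=> semi [_ [lam_lin lam_deg0 lam_sym lam_linf0 lam_der0]] lam1 T1 E1 T_lin E_lin T_rec E_rec.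
pose s := k - 1.
have lam_gsym : gsym (hpair grA s) (reval lamA) by apply: fr_gsym lam_sym.
have lam_deg l : all (hpair grA s) l -> ~~ nilp l -> hpair grA s (dg l + 1, reval lamA l).
  move=> hl nl; have [n [x [d [nE hx LE]]]] := lst_homog (etrans (all_rev _ _) hl).
  have lE : l = rev (lst (shp s x d)) by rewrite -LE revK.
  have n0 : (0 < n)%N by move: nl; rewrite lE nilp_rev_lst lt0n.
  have := lam_deg0 n x d n0 hx; rewrite /hpair /= lE fr_lst dg_shp; congr grA.
  by rewrite /s; ring.
have lam_linf bs : all (hpair grA s) bs -> spl bs (fun a1 a2 =>
    if nilp a2 then 0 else ksign K (dg a1) *: reval lamA ((dg a2 + 1, reval lamA a2) :: a1)) = 0.
  move=> hl; have [n [x [d [nE hx LE]]]] := lst_homog (etrans (all_rev _ _) hl).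
  have -> : bs = rev (lst (shp s x d)) by rewrite -LE revK.
  rewrite -(linf_sumE _ lam_deg hx); first exact: lam_linf0.
  by move=> m; apply: gsym_gsymn.
have lam_der bs i a b : all (hpair grA s) bs -> grA i a ->
    reval lamA ((0, mulA a b) :: bs) = mulA (reval lamA ((0, a) :: bs)) b
    + ksign K (i * (1 + dg bs)) *: mulA a (reval lamA ((0, b) :: bs)).
  move=> hl ha; have [n [x [d [nE hx LE]]]] := lst_homog (etrans (all_rev _ _) hl).
  have -> : bs = rev (lst (shp s x d)) by rewrite -LE revK.
  rewrite /reval /= !rev_cons map_rev revK map_snd_lst (lam_der0 _ _ _ _ _ _ hx ha).
  rewrite dg_rev dg_lst; congr (_ + ksign K (_ * (_ + _)) *: _).
  by apply: eq_bigr => j _; rewrite addrA.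
have t_deg' : of_degree grB grA (-1 + 1) tau by rewrite addNr.
have tP : forall l, all (hpair grB s) l -> ~~ nilp l -> hpair grA s (tp (reval tauInf) l).
  move=> l; have [n] := ubnP (size l); elim: n l => // n IH l ln hl nl.
  have := rec_deg lam_deg Agr h_deg t_deg' T1 T_rec hl nl.
  rewrite /tp addrNK; apply => l' hl' nl' sl; apply: IH => //; lia.
have eP l : all (hpair grB s) l -> ~~ nilp l -> hpair grB s (dg l + 1, reval ellB l).
  move=> hl nl; rewrite -[dg l]addr0.
  apply: (rec_deg lam_deg Bgr s_deg _ E1 E_rec hl nl) => [|l' hl' nl' _]; last exact: tP.
  by rewrite add0r.
have tE := fun y l => recE charK lam_gsym h_lin T1 T_rec tP y (l := l).
have eE := fun y l => recE charK lam_gsym s_lin E1 E_rec tP y (l := l).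
have tS n : gsymn (hpair grB s) n (reval tauInf).
  elim: n => [|n IH]; last exact: (rec_gsym charK lam_lin lam_gsym h_lin T1 T_rec tP IH).
  by move=> us v u ws _; rewrite size_cat /= !addnS.
(* No induction here: the recursion for [ellB] has only values of [tauInf] on its right-hand
   side. *)
have eS n : gsymn (hpair grB s) n (reval ellB).
  have := rec_gsym charK lam_lin lam_gsym s_lin E1 E_rec tP (tS n).
  by move=> S us v u ws hl ln; apply: S => //; apply: leqW.
have hL n (x : 'I_n -> B) d : homog grB x d -> all (hpair grB s) (rev (lst (shp s x d))).
  by move=> hx; rewrite all_rev homog_lst.
have dgE n (x : 'I_n -> B) d : dg (rev (lst (shp s x d))) = \sum_(a < n) (d a + k - 1).
  by rewrite dg_rev dg_lst; apply: eq_bigr => j _; rewrite addrA.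
have frE (W : Type) (F : seq B -> W) n (x : 'I_n -> B) d y :
    F (rcons (lst x) y) = reval F ((0, y) :: rev (lst (shp s x d))).
  by rewrite /reval /= rev_cons map_rev revK map_snd_lst.
split; split => //.
- split => //.
  + move=> n x d n0 hx; have := eP _ (hL _ _ _ hx); rewrite nilp_rev_lst -lt0n => /(_ n0).
    rewrite /hpair /= fr_lst dg_shp; congr grB; rewrite /s; ring.
  + exact: (shsym_gsymn Bgr (erefl s) E_lin eS).
  + move=> n x d hx; rewrite (linf_sumE eS eP hx).
    exact: (linf_eq s_lin t_lin h_lin dA_lin s_d t_d s_t hom s_h dAA lam_lin lam1 lam_linf tP tE eE (hL _ _ _ hx)).
  + move=> n x d i u v hx hu; rewrite !(frE _ _ _ _ d).
    rewrite (ell_mul Agr gcaA gcaB s_lin h_lin s_deg t_deg h_deg semi dB_mul lam_lin lam_deg lam_der tP tE eE v (hL _ _ _ hx) hu).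
    by rewrite dgE.
- move=> n x d n0 hx; have := tP _ (hL _ _ _ hx); rewrite nilp_rev_lst -lt0n => /(_ n0).
  rewrite /hpair /= fr_lst dg_shp; congr grA; rewrite /s; ring.
- exact: (shsym_gsymn Bgr (erefl s) T_lin tS).
- move=> n x d n0 hx; rewrite (linf_sumE tS eP hx).
  have nl : ~~ nilp (rev (lst (shp s x d))) by rewrite nilp_rev_lst -lt0n.
  have := morphism_eq t_lin h_lin dA_lin t_d hom dAA lam_lin lam1 lam_linf tP tE eE (hL _ _ _ hx) nl.
  rewrite /tell => ->.
  by rewrite (lam_sumE charK lam_gsym tP n0 hx).
- move=> n x d i y z hx hy; rewrite (frE _ _ _ _ d).
  rewrite (phi_mul Agr gcaA h_lin t_deg h_deg semi lam_lin lam_deg lam_der tP tE z (hL _ _ _ hx) hy).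
  rewrite -sum_kcol2E; apply: eq_bigr => c _; rewrite scalerA dg_rev dg_blk.
  congr (_ * ksign K (_ * _) *: _); first by apply: eq_bigr => a _; rewrite addrA.
  by rewrite /reval /= !rev_cons !map_rev !revK !map_snd_blk.
Qed.
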